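(* Let $G\subset\mathbb{R}$ be a nontrivial additive subgroup which is not isomorphic to $\mathbb{Z}$, and let $\mathrm{Vir}_G$ be the corresponding higher rank Virasoro algebra. Let $K(0)$ be the kernel of the canonical epimorphism $M(0)\to L(0)$ from the Verma module $M(0)$ onto its simple top $L(0)$, the trivial $\mathrm{Vir}_G$-module. Then $K(0)$ is a simple $\mathrm{Vir}_G$-module on which every root vector of $\mathfrak{n}_+$ acts locally nilpotently, but $K(0)$ is not a highest weight module. In particular, it is not true that every simple $\mathrm{Vir}_G$-module on which all root vectors of $\mathfrak{n}_+$ act locally nilpotently is a highest weight module.
   Context: Everything is over $\mathbb{C}$. $\mathrm{Vir}_G$ has basis $\{e_i:i\in G\}\cup\{c\}$, where $c$ is central and $[e_i,e_j]=(j-i)e_{i+j}+\delta_{i,-j}\frac{i^3-i}{12}c$ for $i,j\in G$. The subalgebras $\mathfrak{n}_+$ and $\mathfrak{n}_-$ are spanned by the $e_i$ with $i>0$ and with $i<0$, respectively, and $\mathfrak{h}$ is spanned by $e_0$ and $c$. The root vectors of $\mathfrak{n}_+$ are the nonzero scalar multiples of the $e_i$, $i\in G$, $i>0$. $M(0)$ is the Verma module of highest weight $0$, i.e. the quotient of $U(\mathrm{Vir}_G)$ by the left ideal generated by $\mathfrak{n}_+$, $e_0$ and $c$. An element $x$ acts locally nilpotently on a module $V$ if for every $v\in V$ there is a positive integer $m$ with $x^mv=0$. A highest weight module is a module generated by a nonzero vector $v$ such that $\mathfrak{n}_+v=0$ and $hv=\lambda(h)v$ for all $h\in\mathfrak{h}$,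 for some $\lambda\in\mathfrak{h}^*$. *)

(* Defs.v *)
From HB Require Import structures.
From mathcomp Require Import all_boot all_order all_algebra finmap.
From mathcomp Require Import boolp reals.
From mathcomp.real_closed Require Import complex.
From mathcomp.multinomials Require Import monalg.
From mathcomp Require Import ring.

Set Implicit Arguments.
Unset Strict Implicit.
Unset Printing Implicit Defensive.

Import Order.TTheory GRing.Theory Num.Theory.

Local Open Scope ring_scope.
Local Open Scope quotient_scope.

HB.mixin Record Lmodule_isLieAlgebra (K : fieldType) L of GRing.Lmodule K L := {
  lie : L -> L -> L;
  lieDl : forall x y z, lie (x + y) z = lie x z + lie y z;
  lieZl : forall a x y, lie (a *: x) y = a *: lie x y;
  lieDr : forall x y z, lie x (y + z) = lie x y + lie x z;
  lieZr : forall a x y, lie x (a *: y) = a *: lie x y;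
  liexx : forall x, lie x x = 0;
  lie_jacobi : forall x y z,
    lie x (lie y z) + lie y (lie z x) + lie z (lie x y) = 0
}.

#[short(type="lieAlgType")]
HB.structure Definition LieAlgebra (K : fieldType) :=
  {L of Lmodule_isLieAlgebra K L & GRing.Lmodule K L}.

HB.mixin Record Lmodule_isLieModule (K : fieldType) (L : lieAlgType K) V
    of GRing.Lmodule K V := {
  lact : L -> V -> V;
  lactDl : forall x y v, lact (x + y) v = lact x v + lact y v;
  lactZl : forall a x v, lact (a *: x) v = a *: lact x v;
  lactDr : forall x v w, lact x (v + w) = lact x v + lact x w;
  lactZr : forall a x v, lact x (a *: v) = a *: lact x v;
  lact_lie : forall x y v,
    lact (lie x y) v = lact x (lact y v) - lact y (lact x v)
}.

#[short(type="lieModType")]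
HB.structure Definition LieModule (K : fieldType) (L : lieAlgType K) :=
  {V of Lmodule_isLieModule K L V & GRing.Lmodule K V}.

Record lieSubmod (K : fieldType) (L : lieAlgType K) (V : lieModType L) :=
  LieSubmod {
    lie_submod_pred :> {pred V};
    lie_submodP : submod_closed lie_submod_pred;
    lact_closed : forall (x : L) (v : V),
      v \in lie_submod_pred -> lact x v \in lie_submod_pred
  }.

HB.instance Definition _ (K : fieldType) (L : lieAlgType K) (V : lieModType L)
    (S : lieSubmod V) :=
  GRing.isSubmodClosed.Build K V (lie_submod_pred S) (lie_submodP S).

HB.mixin Record isLieEquivariant (K : fieldType) (L : lieAlgType K)
    (V W : lieModType L) (f : V -> W) := {
  lact_morph : forall (x : L) (v : V), f (lact x v) = lact x (f v)
}.

#[short(type="lieHom")]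
HB.structure Definition LieHom (K : fieldType) (L : lieAlgType K)
    (V W : lieModType L) :=
  {f of isLieEquivariant K L V W f & @GRing.Linear K V W *:%R f}.

Section LieModuleTheory.
Variables (K : fieldType) (L : lieAlgType K) (V : lieModType L).

Lemma lact0r (x : L) : lact x (0 : V) = 0.
Proof. by have := lactZr 0 x (0 : V); rewrite !scale0r. Qed.

Lemma lactBr (x : L) (v w : V) : lact x (v - w) = lact x v - lact x w.
Proof. by rewrite -scaleN1r lactDr lactZr scaleN1r. Qed.

Definition simple_lmod : Prop :=
  (exists v : V, v != 0) /\
  forall S : lieSubmod V,
    (forall v, v \in S -> v = 0) \/ (forall v, v \in S).

Definition generates (v : V) : Prop :=
  forall S : lieSubmod V, v \in S -> forall w, w \in S.

Definition locally_nilpotent (x : L) : Prop :=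
  forall v : V, exists m : nat, (0 < m)%N /\ iter m (lact x) v = 0.

Definition maximal_submod (S : lieSubmod V) : Prop :=
  (exists v, v \notin S) /\
  forall T : lieSubmod V, {subset S <= T} ->
    {subset T <= S} \/ (forall v, v \in T).

Definition rad_pred : {pred V} :=
  fun v => `[< forall S : lieSubmod V, maximal_submod S -> v \in S >].

Fact rad_submod_closed : submod_closed rad_pred.
Proof.
split=> [|a v w /asboolP Hv /asboolP Hw]; apply/asboolP => S mS.
  exact: rpred0.
by rewrite rpredD ?rpredZ ?Hv ?Hw.
Qed.

Fact rad_lact_closed (x : L) (v : V) : v \in rad_pred -> lact x v \in rad_pred.
Proof.
by move=> /asboolP Hv; apply/asboolP => S mS; rewrite lact_closed ?Hv.
Qed.

Definition lie_rad : lieSubmod V := LieSubmod rad_submod_closed rad_lact_closed.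

End LieModuleTheory.

Arguments simple_lmod {K L} V.
Arguments locally_nilpotent {K L} V x.
Arguments lie_rad {K L} V.

(** [L] is a phantom parameter that selects the zero action of [L]. *)
Definition triv_lmod (K : fieldType) (L : lieAlgType K) : Type := K^o.

Section TrivialModule.
Variables (K : fieldType) (L : lieAlgType K).
HB.instance Definition _ := GRing.Lmodule.copy (triv_lmod L) K^o.

Let act (x : L) (v : triv_lmod L) : triv_lmod L := 0.

Fact triv_lactD x v w : act x (v + w) = act x v + act x w.
Proof. by rewrite addr0. Qed.
Fact triv_lactZ a x v : act x (a *: v) = a *: act x v.
Proof. by rewrite scaler0. Qed.
Fact triv_lactDl x y v : act (x + y) v = act x v + act y v.
Proof. by rewrite addr0. Qed.
Fact triv_lactZl a x v : act (a *: x) v = a *: act x v.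
Proof. by rewrite scaler0. Qed.
Fact triv_lact_lie x y v :
  act (lie x y) v = act x (act y v) - act y (act x v).
Proof. by rewrite subr0. Qed.

HB.instance Definition _ := Lmodule_isLieModule.Build K L (triv_lmod L)
  triv_lactDl triv_lactZl triv_lactD triv_lactZ triv_lact_lie.
End TrivialModule.

Section SubModule.
Variables (K : fieldType) (L : lieAlgType K) (V : lieModType L).
Variable S : lieSubmod V.

Record sub_lmod : predArgType :=
  SubLmod { sub_lmod_val :> V; sub_lmodP : sub_lmod_val \in S }.
HB.instance Definition _ := [isSub for sub_lmod_val].
HB.instance Definition _ := [Choice of sub_lmod by <:].
HB.instance Definition _ := [SubChoice_isSubLmodule of sub_lmod by <:].

Definition sub_lact (x : L) (v : sub_lmod) : sub_lmod :=
  SubLmod (lact_closed x (sub_lmodP v)).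

Fact sub_lactDl x y v : sub_lact (x + y) v = sub_lact x v + sub_lact y v.
Proof. by apply: val_inj; rewrite /= lactDl. Qed.
Fact sub_lactZl a x v : sub_lact (a *: x) v = a *: sub_lact x v.
Proof. by apply: val_inj; rewrite /= lactZl. Qed.
Fact sub_lactDr x v w : sub_lact x (v + w) = sub_lact x v + sub_lact x w.
Proof. by apply: val_inj; rewrite /= lactDr. Qed.
Fact sub_lactZr a x v : sub_lact x (a *: v) = a *: sub_lact x v.
Proof. by apply: val_inj; rewrite /= lactZr. Qed.
Fact sub_lact_lie x y v :
  sub_lact (lie x y) v =
  sub_lact x (sub_lact y v) - sub_lact y (sub_lact x v).
Proof. by apply: val_inj; rewrite /= lact_lie. Qed.

HB.instance Definition _ := Lmodule_isLieModule.Build K L sub_lmod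
  sub_lactDl sub_lactZl sub_lactDr sub_lactZr sub_lact_lie.
End SubModule.

Section QuotientModule.
Variables (K : fieldType) (L : lieAlgType K) (V : lieModType L).
Variable S : lieSubmod V.

Definition quot_lmod : Type := Quotient.quot S.
HB.instance Definition _ := GRing.Zmodule.on quot_lmod.

Definition quot_proj (v : V) : quot_lmod := \pi_(Quotient.quot S) v.

Lemma quot_projD v w : quot_proj (v + w) = quot_proj v + quot_proj w.
Proof. exact: (raddfD (\pi_(Quotient.quot S))). Qed.

Lemma quot_projE v w : (quot_proj v == quot_proj w) = (v - w \in S).
Proof. by rewrite Quotient.idealrBE. Qed.

Lemma quot_projK : cancel (repr : Quotient.quot S -> V) quot_proj.
Proof. exact: reprK. Qed.

Lemma quot_lift (f : V -> V) (fB : forall v w, f (v - w) = f v - f w)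
    (fS : forall v, v \in S -> f v \in S) v :
  quot_proj (f (repr (quot_proj v : Quotient.quot S))) = quot_proj (f v).
Proof. by apply/eqP; rewrite quot_projE -fB fS // -quot_projE quot_projK. Qed.

Definition quot_scale (a : K) (q : quot_lmod) : quot_lmod :=
  quot_proj (a *: repr (q : Quotient.quot S)).

Lemma quot_projZ a v : quot_scale a (quot_proj v) = quot_proj (a *: v).
Proof.
by apply: quot_lift => [? ?|? ?]; rewrite ?scalerBr ?rpredZ.
Qed.

Lemma quot_ind (P : quot_lmod -> Prop) :
  (forall v, P (quot_proj v)) -> forall q, P q.
Proof. by move=> Pv q; rewrite -[q]quot_projK. Qed.

Fact quot_scaleA a b q : quot_scale a (quot_scale b q) = quot_scale (a * b) q.
Proof. by elim/quot_ind: q => v; rewrite !quot_projZ scalerA. Qed.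
Fact quot_scale1 : left_id 1 quot_scale.
Proof. by elim/quot_ind => v; rewrite quot_projZ scale1r. Qed.
Fact quot_scaleDr : right_distributive quot_scale +%R.
Proof.
move=> a; elim/quot_ind => v; elim/quot_ind => w.
by rewrite -quot_projD !quot_projZ scalerDr quot_projD.
Qed.
Fact quot_scaleDl q : {morph quot_scale^~ q : a b / a + b}.
Proof.
by elim/quot_ind: q => v a b; rewrite !quot_projZ scalerDl quot_projD.
Qed.
HB.instance Definition _ := GRing.Zmodule_isLmodule.Build K quot_lmod
  quot_scaleA quot_scale1 quot_scaleDr quot_scaleDl.

Definition quot_lact (x : L) (q : quot_lmod) : quot_lmod :=
  quot_proj (lact x (repr (q : Quotient.quot S))).

Lemma quot_proj_lact x v : quot_lact x (quot_proj v) = quot_proj (lact x v).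
Proof.
by apply: quot_lift => [? ?|? ?]; rewrite ?lactBr ?lact_closed.
Qed.

Lemma quot_projZE a v : quot_proj (a *: v) = a *: quot_proj v.
Proof. by rewrite -quot_projZ. Qed.

Fact quot_lactDl x y q : quot_lact (x + y) q = quot_lact x q + quot_lact y q.
Proof. by elim/quot_ind: q => v; rewrite !quot_proj_lact lactDl quot_projD. Qed.
Fact quot_lactZl a x q : quot_lact (a *: x) q = a *: quot_lact x q.
Proof. by elim/quot_ind: q => v; rewrite !quot_proj_lact lactZl quot_projZE. Qed.
Fact quot_lactDr x p q : quot_lact x (p + q) = quot_lact x p + quot_lact x q.
Proof.
elim/quot_ind: p => v; elim/quot_ind: q => w.
by rewrite -quot_projD !quot_proj_lact lactDr quot_projD.
Qed.
Fact quot_lactZr a x q : quot_lact x (a *: q) = a *: quot_lact x q.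
Proof.
elim/quot_ind: q => v.
by rewrite -quot_projZE !quot_proj_lact lactZr quot_projZE.
Qed.
Fact quot_lact_lie x y q :
  quot_lact (lie x y) q =
  quot_lact x (quot_lact y q) - quot_lact y (quot_lact x q).
Proof.
elim/quot_ind: q => v; rewrite !quot_proj_lact lact_lie.
by rewrite -[in RHS]scaleN1r -quot_projZE -quot_projD scaleN1r.
Qed.
HB.instance Definition _ := Lmodule_isLieModule.Build K L quot_lmod
  quot_lactDl quot_lactZl quot_lactDr quot_lactZr quot_lact_lie.

Fact quot_proj_is_zmod_morphism : zmod_morphism quot_proj.
Proof. exact: (raddfB (\pi_(Quotient.quot S))). Qed.
HB.instance Definition _ :=
  GRing.isZmodMorphism.Build V quot_lmod quot_proj quot_proj_is_zmod_morphism.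
HB.instance Definition _ :=
  GRing.isScalable.Build K V quot_lmod *:%R quot_proj quot_projZE.
Fact quot_proj_is_equivariant (x : L) (v : V) :
  quot_proj (lact x v) = lact x (quot_proj v).
Proof. by rewrite -quot_proj_lact. Qed.
HB.instance Definition _ :=
  isLieEquivariant.Build K L V quot_lmod quot_proj quot_proj_is_equivariant.

End QuotientModule.

Section Kernel.
Variables (K : fieldType) (L : lieAlgType K) (V W : lieModType L).
Variable f : lieHom V W.

Definition lie_ker_pred : {pred V} := fun v => f v == 0.

Fact lie_ker_submod_closed : submod_closed lie_ker_pred.
Proof.
split=> [|a v w /eqP fv /eqP fw]; apply/eqP; first exact: raddf0.
by rewrite linearP /= fv fw scaler0 addr0.
Qed.

Fact lie_ker_lact_closed (x : L) (v : V) :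
  v \in lie_ker_pred -> lact x v \in lie_ker_pred.
Proof. by move=> /eqP fv; apply/eqP; rewrite lact_morph fv lact0r. Qed.

Definition lie_ker : lieSubmod V :=
  LieSubmod lie_ker_submod_closed lie_ker_lact_closed.
End Kernel.

Definition top_lmod (K : fieldType) (L : lieAlgType K) (V : lieModType L) :
  lieModType L := quot_lmod (lie_rad V).

Definition top_proj (K : fieldType) (L : lieAlgType K) (V : lieModType L) :
  lieHom V (top_lmod V) := @quot_proj K L V (lie_rad V).

Section Span.
Variables (K : fieldType) (V : lmodType K).
Implicit Type X : V -> Prop.

Definition lspan X : {pred V} :=
  fun v => `[< forall S : submodClosed V, (forall u, X u -> u \in S) -> v \in S >].

Fact lspan_submod_closed X : submod_closed (lspan X).
Proof.
split=> [|a v w /asboolP Hv /asboolP Hw]; apply/asboolP => S XS.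
  exact: rpred0.
by rewrite rpredD ?rpredZ ?Hv ?Hw.
Qed.
HB.instance Definition _ X :=
  GRing.isSubmodClosed.Build K V (lspan X) (lspan_submod_closed X).

Record lspan_type X : predArgType :=
  LspanType { lspan_val :> V; lspan_valP : lspan_val \in lspan X }.
HB.instance Definition _ X := [isSub for @lspan_val X].
HB.instance Definition _ X := [Choice of lspan_type X by <:].
HB.instance Definition _ X := [SubChoice_isSubLmodule of lspan_type X by <:].
End Span.

(** T(L) is presented as the free unital associative algebra on the underlying
    set of [L] modulo the linearity of the inclusion of [L]; the relations
    [UeaAdd] and [UeaScale] below therefore come on top of the usual
    x y - y x - [x, y]. *)
Definition free_alg (K : fieldType) (L : choiceType) : Type :=
  {malg K[{fmonom L}]}.

Section FreeAlgebra.
Variables (K : fieldType) (L : choiceType).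
HB.instance Definition _ := GRing.Lalgebra.copy (free_alg K L) {malg K[{fmonom L}]}.

Fact free_alg_scalerAr (a : K) (x y : free_alg K L) : a *: (x * y) = x * (a *: y).
Proof.
have cen (u : {malg K[{fmonom L}]}) : u * a%:MP = a *: u.
  rewrite -mul_malgC [u in RHS]monalgE {1}[u]monalgE.
  rewrite mulr_suml mulr_sumr; apply: eq_bigr => k _.
  by rewrite !malgM_def !fgmulUU mulm1 mul1m mulrC.
suff: forall x y : {malg K[{fmonom L}]}, a *: (x * y) = x * (a *: y) by [].
by move=> u v; rewrite -[a *: v]mul_malgC mulrA cen scalerAl.
Qed.
HB.instance Definition _ :=
  GRing.Lalgebra_isAlgebra.Build K (free_alg K L) free_alg_scalerAr.

Definition free_gen (x : L) : free_alg K L := << fmu x >>.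
End FreeAlgebra.

Section Ideals.
Variables (K : fieldType) (A : algType K).
Implicit Types (X : A -> Prop) (I : {pred A}).

Definition left_ideal I : Prop :=
  submod_closed I /\ forall a x, x \in I -> a * x \in I.

Definition two_sided_ideal I : Prop :=
  left_ideal I /\ forall a x, x \in I -> x * a \in I.

Definition left_ideal_gen X : {pred A} :=
  fun x => `[< forall I, left_ideal I -> (forall g, X g -> g \in I) -> x \in I >].

Definition two_sided_ideal_gen X : {pred A} :=
  fun x =>
    `[< forall I, two_sided_ideal I -> (forall g, X g -> g \in I) -> x \in I >].

Fact left_ideal_genP X : left_ideal (left_ideal_gen X).
Proof.
split=> [|a x /asboolP Hx]; last first.
  by apply/asboolP => I idI XI; case: (idI) => _; apply; exact: Hx.
split=> [|a x y /asboolP Hx /asboolP Hy]; apply/asboolP => I idI XI.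
  by case: idI => [] [].
by case: (idI) => [] [_ cI] _; apply: cI; [exact: Hx | exact: Hy].
Qed.

Fact two_sided_ideal_genP X : two_sided_ideal (two_sided_ideal_gen X).
Proof.
split=> [|a x /asboolP Hx]; last first.
  by apply/asboolP => I idI XI; case: (idI) => _; apply; exact: Hx.
split=> [|a x /asboolP Hx]; last first.
  by apply/asboolP => I idI XI; case: (idI) => [] [_ +] _; apply; exact: Hx.
split=> [|a x y /asboolP Hx /asboolP Hy]; apply/asboolP => I idI XI.
  by case: idI => [] [] [].
by case: (idI) => [] [] [_ cI] _ _; apply: cI; [exact: Hx | exact: Hy].
Qed.
End Ideals.

Section Enveloping.
Variables (K : fieldType) (L : lieAlgType K).
Local Notation F := (free_alg K L).
Local Notation i := (@free_gen K L).

Inductive uea_rel : F -> Prop :=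
| UeaAdd x y : uea_rel (i (x + y) - (i x + i y))
| UeaScale a x : uea_rel (i (a *: x) - a *: i x)
| UeaLie x y : uea_rel (i x * i y - i y * i x - i (lie x y)).

Definition uea_ideal : {pred F} := two_sided_ideal_gen uea_rel.

Fact uea_ideal_submod_closed : submod_closed uea_ideal.
Proof. by case: (two_sided_ideal_genP uea_rel) => [] []. Qed.
HB.instance Definition _ :=
  GRing.isSubmodClosed.Build K F uea_ideal uea_ideal_submod_closed.

Lemma uea_idealMl a x : x \in uea_ideal -> a * x \in uea_ideal.
Proof. by case: (two_sided_ideal_genP uea_rel) => [] [_ +] _; apply. Qed.
Lemma uea_idealMr a x : x \in uea_ideal -> x * a \in uea_ideal.
Proof. by case: (two_sided_ideal_genP uea_rel) => _; apply. Qed.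

Lemma uea_ideal_proper : 1 \notin uea_ideal.
Proof.
have [eps [eps1 epsD epsZ epsM epsi]] : exists eps : F -> K,
    [/\ eps 1 = 1, forall u v, eps (u + v) = eps u + eps v,
        forall a u, eps (a *: u) = a * eps u,
        forall u v, eps (u * v) = eps u * eps v & forall x, eps (i x) = 0].
  exists (mcoeff (mone : {fmonom L})); split.
  - by rewrite mcoeff1 eqxx.
  - exact: mcoeffD.
  - by move=> a u; exact: mcoeffZ.
  - exact: (rmorphM (mcoeff (mone : {fmonom L}) : {malg K[{fmonom L}]} -> K)).
  - move=> x; rewrite mcoeffU1; case: eqP => // /(congr1 (@fmonom_val L)).
    by rewrite fmU fm1.
have eps0 : eps 0 = 0 by have := epsZ 0 0; rewrite scale0r mul0r.
have epsB u v : eps (u - v) = eps u - eps v.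
  by rewrite epsD -scaleN1r epsZ mulN1r.
pose I : {pred F} := fun u => eps u == 0.
have inI u : (u \in I) = (eps u == 0) by [].
apply/negP => /asboolP /(_ I) H; suff: 1 \in I by rewrite inI eps1 oner_eq0.
apply: H.
  split; [split; [split|]|] => [|a u v|a u|a u]; rewrite !inI.
  - by rewrite eps0.
  - by rewrite epsD epsZ => /eqP -> /eqP ->; rewrite mulr0 addr0.
  - by rewrite epsM => /eqP ->; rewrite mulr0.
  - by rewrite epsM => /eqP ->; rewrite mul0r.
move=> _ [x y|a x|x y]; rewrite inI.
- by rewrite epsB epsD !epsi addr0 subr0.
- by rewrite epsB epsZ !epsi mulr0 subr0.
- rewrite epsB epsB [X in X - _ - _]epsM [X in _ - X - _]epsM.
  by rewrite !epsi mulr0 !subr0.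
Qed.

Definition uea : Type := Quotient.quot uea_ideal.
HB.instance Definition _ := GRing.Zmodule.on uea.

Definition uea_proj (u : F) : uea := \pi_(Quotient.quot uea_ideal) u.

Lemma uea_projD u v : uea_proj (u + v) = uea_proj u + uea_proj v.
Proof. exact: (raddfD (\pi_(Quotient.quot uea_ideal))). Qed.
Lemma uea_projB u v : uea_proj (u - v) = uea_proj u - uea_proj v.
Proof. exact: (raddfB (\pi_(Quotient.quot uea_ideal))). Qed.
Lemma uea_projE u v : (uea_proj u == uea_proj v) = (u - v \in uea_ideal).
Proof. by rewrite Quotient.idealrBE. Qed.
Lemma uea_projK : cancel (repr : Quotient.quot uea_ideal -> F) uea_proj.
Proof. exact: reprK. Qed.
Lemma uea_ind (P : uea -> Prop) : (forall u, P (uea_proj u)) -> forall q, P q.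
Proof. by move=> Pv q; rewrite -[q]uea_projK. Qed.

Definition uea_one : uea := uea_proj 1.
Definition uea_mul (p q : uea) : uea :=
  uea_proj (repr (p : Quotient.quot uea_ideal) * repr (q : Quotient.quot uea_ideal)).
Definition uea_scale (a : K) (q : uea) : uea :=
  uea_proj (a *: repr (q : Quotient.quot uea_ideal)).

Lemma uea_repr u : repr (uea_proj u : Quotient.quot uea_ideal) - u \in uea_ideal.
Proof. by rewrite -uea_projE uea_projK. Qed.

Lemma uea_projM u v : uea_mul (uea_proj u) (uea_proj v) = uea_proj (u * v).
Proof.
apply/eqP; rewrite uea_projE; set u' := repr _; set v' := repr _.
have -> : u' * v' - u * v = (u' - u) * v' + u * (v' - v).
  by rewrite mulrBl mulrBr addrA subrK.
by apply: rpredD; [apply: uea_idealMr | apply: uea_idealMl]; exact: uea_repr.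
Qed.

Lemma uea_projZ a u : uea_scale a (uea_proj u) = uea_proj (a *: u).
Proof. by apply/eqP; rewrite uea_projE -scalerBr rpredZ ?uea_repr. Qed.

Fact uea_mulA : associative uea_mul.
Proof.
do 3![elim/uea_ind => ?].
by rewrite !uea_projM mulrA.
Qed.
Fact uea_mul1l : left_id uea_one uea_mul.
Proof. by elim/uea_ind => u; rewrite uea_projM mul1r. Qed.
Fact uea_mul1r : right_id uea_one uea_mul.
Proof. by elim/uea_ind => u; rewrite uea_projM mulr1. Qed.
Fact uea_mulDl : left_distributive uea_mul +%R.
Proof.
do 3![elim/uea_ind => ?].
by rewrite -uea_projD !uea_projM mulrDl uea_projD.
Qed.
Fact uea_mulDr : right_distributive uea_mul +%R.
Proof.
do 3![elim/uea_ind => ?].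
by rewrite -uea_projD !uea_projM mulrDr uea_projD.
Qed.
Fact uea_one_neq0 : uea_one != 0.
Proof.
have <- : uea_proj 0 = 0 by exact: (raddf0 (\pi_(Quotient.quot uea_ideal))).
by rewrite uea_projE subr0 uea_ideal_proper.
Qed.
HB.instance Definition _ := GRing.Zmodule_isNzRing.Build uea
  uea_mulA uea_mul1l uea_mul1r uea_mulDl uea_mulDr uea_one_neq0.

Fact uea_scaleA a b q : uea_scale a (uea_scale b q) = uea_scale (a * b) q.
Proof. by elim/uea_ind: q => u; rewrite !uea_projZ scalerA. Qed.
Fact uea_scale1 : left_id 1 uea_scale.
Proof. by elim/uea_ind => u; rewrite uea_projZ scale1r. Qed.
Fact uea_scaleDr : right_distributive uea_scale +%R.
Proof.
move=> a; do 2![elim/uea_ind => ?].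
by rewrite -uea_projD !uea_projZ scalerDr uea_projD.
Qed.
Fact uea_scaleDl q : {morph uea_scale^~ q : a b / a + b}.
Proof.
by elim/uea_ind: q => u a b; rewrite !uea_projZ scalerDl uea_projD.
Qed.
HB.instance Definition _ := GRing.Zmodule_isLmodule.Build K uea
  uea_scaleA uea_scale1 uea_scaleDr uea_scaleDl.

Fact uea_scaleAl (a : K) (p q : uea) : a *: (p * q) = a *: p * q.
Proof.
elim/uea_ind: p => u; elim/uea_ind: q => v.
rewrite /GRing.mul /GRing.scale /=.
by rewrite uea_projM !uea_projZ uea_projM scalerAl.
Qed.
HB.instance Definition _ := GRing.Lmodule_isLalgebra.Build K uea uea_scaleAl.
Fact uea_scaleAr (a : K) (p q : uea) : a *: (p * q) = p * (a *: q).
Proof.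
elim/uea_ind: p => u; elim/uea_ind: q => v.
rewrite /GRing.mul /GRing.scale /=.
by rewrite uea_projM !uea_projZ uea_projM scalerAr.
Qed.
HB.instance Definition _ := GRing.Lalgebra_isAlgebra.Build K uea uea_scaleAr.

Definition uea_gen (x : L) : uea := uea_proj (i x).

Lemma uea_rel0 u : uea_rel u -> u \in uea_ideal.
Proof. by move=> ru; apply/asboolP => I _; apply. Qed.

Lemma uea_genD x y : uea_gen (x + y) = uea_gen x + uea_gen y.
Proof.
by apply/eqP; rewrite -uea_projD uea_projE uea_rel0 //; exact: UeaAdd.
Qed.
Lemma uea_genZ a x : uea_gen (a *: x) = a *: uea_gen x.
Proof.
apply/eqP; rewrite [a *: uea_gen x]uea_projZ uea_projE uea_rel0 //.
exact: UeaScale.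
Qed.
Lemma uea_gen_lie x y :
  uea_gen (lie x y) = uea_gen x * uea_gen y - uea_gen y * uea_gen x.
Proof.
apply/esym/eqP; rewrite /GRing.mul /= !uea_projM -uea_projB uea_projE.
by rewrite uea_rel0 //; exact: UeaLie.
Qed.

Definition uea_lact (x : L) (q : uea) : uea := uea_gen x * q.

Fact uea_lactDl x y q : uea_lact (x + y) q = uea_lact x q + uea_lact y q.
Proof. by rewrite /uea_lact uea_genD mulrDl. Qed.
Fact uea_lactZl a x q : uea_lact (a *: x) q = a *: uea_lact x q.
Proof. by rewrite /uea_lact uea_genZ scalerAl. Qed.
Fact uea_lactDr x p q : uea_lact x (p + q) = uea_lact x p + uea_lact x q.
Proof. exact: mulrDr. Qed.
Fact uea_lactZr a x q : uea_lact x (a *: q) = a *: uea_lact x q.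
Proof. by rewrite /uea_lact scalerAr. Qed.
Fact uea_lact_lie x y q :
  uea_lact (lie x y) q = uea_lact x (uea_lact y q) - uea_lact y (uea_lact x q).
Proof. by rewrite /uea_lact uea_gen_lie mulrBl !mulrA. Qed.
HB.instance Definition _ := Lmodule_isLieModule.Build K L uea
  uea_lactDl uea_lactZl uea_lactDr uea_lactZr uea_lact_lie.

Section LeftIdeal.
Variable X : uea -> Prop.
Fact left_ideal_gen_submod_closed : submod_closed (left_ideal_gen X).
Proof. by case: (left_ideal_genP X). Qed.
Fact left_ideal_gen_lact_closed (x : L) (q : uea) :
  q \in left_ideal_gen X -> lact x q \in left_ideal_gen X.
Proof. by case: (left_ideal_genP X) => _; apply. Qed.

Definition left_ideal_submod : lieSubmod uea :=
  LieSubmod left_ideal_gen_submod_closed left_ideal_gen_lact_closed.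
End LeftIdeal.

End Enveloping.

Section JacobiOnGenerators.
Variables (K : fieldType) (L : lmodType K) (br : L -> L -> L).
Hypotheses (brDl : forall x y z, br (x + y) z = br x z + br y z)
  (brZl : forall a x y, br (a *: x) y = a *: br x y)
  (brDr : forall x y z, br x (y + z) = br x y + br x z)
  (brZr : forall a x y, br x (a *: y) = a *: br x y)
  (brC : forall x y, br x y = - br y x).

Let J x y z := br x (br y z) + br y (br z x) + br z (br x y).

Let J_rot x y z : J x y z = J y z x.
Proof. by rewrite /J -addrA addrC. Qed.
Let J_D x1 x2 y z : J (x1 + x2) y z = J x1 y z + J x2 y z.
Proof.
by rewrite /J !(brDl, brDr) (addrACA (br x1 _)) (addrACA (_ + _)).
Qed.
Let J_Z a x y z : J (a *: x) y z = a *: J x y z.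
Proof. by rewrite /J !(brZl, brZr) !scalerDr. Qed.

Variable B : L -> Prop.
Hypothesis B_ind : forall P : L -> Prop, P 0 ->
  (forall x y, P x -> P y -> P (x + y)) -> (forall a x, P x -> P (a *: x)) ->
  (forall x, B x -> P x) -> forall x, P x.

Lemma jacobi_central c : (forall x, br x c = 0) -> forall y z,
  [/\ br c (br y z) + br y (br z c) + br z (br c y) = 0,
      br z (br c y) + br c (br y z) + br y (br z c) = 0 &
      br y (br z c) + br z (br c y) + br c (br y z) = 0].
Proof.
move=> c0 y z; have r0 x : br x 0 = 0 by have := brZr 0 x 0; rewrite !scale0r.
by rewrite !(brC c) !c0 !(oppr0, r0) !addr0.
Qed.

Lemma jacobi_generators :
  (forall x y z, B x -> B y -> B z ->
     br x (br y z) + br y (br z x) + br z (br x y) = 0) ->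
  forall x y z, br x (br y z) + br y (br z x) + br z (br x y) = 0.
Proof.
move=> JB x y z; rewrite -/(J x y z).
have Jlin v w : (forall x, B x -> J x v w = 0) -> forall u, J u v w = 0.
  move=> Jx; apply: B_ind => // [|u1 u2 H1 H2|a u Hu].
  - by have := J_Z 0 0 v w; rewrite !scale0r.
  - by rewrite J_D H1 H2 addr0.
  - by rewrite J_Z Hu scaler0.
apply: (Jlin y z) => u Bu; rewrite J_rot; apply: (Jlin z u) => v Bv.
by rewrite J_rot; apply: (Jlin u v) => w Bw; rewrite J_rot; exact: JB.
Qed.
End JacobiOnGenerators.

Section Virasoro.
Variables (R : realType) (G : zmodClosed R).
Local Notation C := (complex R).

Record grp : predArgType := Grp { grp_val :> R; grp_valP : grp_val \in G }.
HB.instance Definition _ := [isSub for grp_val].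
HB.instance Definition _ := [Choice of grp by <:].
HB.instance Definition _ := [SubChoice_isSubZmodule of grp by <:].

(** [Some i] indexes e_i and [None] indexes the central element c. *)
Definition vir : Type := {malg C[option grp]}.
HB.instance Definition _ := GRing.Lmodule.copy vir {malg C[option grp]}.

Definition vir_e (i : grp) : vir := << Some i >>.
Definition vir_c : vir := << None >>.

Definition vir_basis_lie (a b : option grp) : vir :=
  match a, b with
  | Some i, Some j =>
      real_complex R (val j - val i) *: vir_e (i + j)
      + ((i == - j)%:R * real_complex R ((val i ^+ 3 - val i) / 12%:R)) *: vir_c
  | _, _ => 0
  end.

Definition vir_lie (x y : vir) : vir :=
  \sum_(a <- msupp (x : {malg C[option grp]}))
    \sum_(b <- msupp (y : {malg C[option grp]}))
      (x@_a * y@_b) *: vir_basis_lie a b.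

Lemma vir_lieE (d1 d2 : {fset option grp}) (x y : vir) :
  (msupp (x : {malg C[option grp]}) `<=` d1)%fset ->
  (msupp (y : {malg C[option grp]}) `<=` d2)%fset ->
  vir_lie x y =
  \sum_(a <- d1) \sum_(b <- d2) (x@_a * y@_b) *: vir_basis_lie a b.
Proof.
move=> s1 s2; rewrite /vir_lie (big_fset_incl _ s1) /=; last first.
  move=> a _ /mcoeff_outdom xa0; rewrite big1 // => b _.
  by rewrite xa0 mul0r scale0r.
apply: eq_bigr => a _; apply: (big_fset_incl _ s2) => b _ /mcoeff_outdom ->.
by rewrite mulr0 scale0r.
Qed.

Fact vir_lieDl x y z : vir_lie (x + y) z = vir_lie x z + vir_lie y z.
Proof.
pose d := (msupp (x : {malg C[option grp]}) `|` msupp (y : {malg C[option grp]}))%fset.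
rewrite !(@vir_lieE d (msupp (z : {malg C[option grp]}))) ?fsubset_refl
  ?fsubsetUl ?fsubsetUr ?msuppD_le // -big_split; apply: eq_bigr => a _ /=.
rewrite -big_split; apply: eq_bigr => b _ /=.
by rewrite mcoeffD mulrDl scalerDl.
Qed.

Fact vir_lieDr x y z : vir_lie x (y + z) = vir_lie x y + vir_lie x z.
Proof.
pose d := (msupp (y : {malg C[option grp]}) `|` msupp (z : {malg C[option grp]}))%fset.
rewrite !(@vir_lieE (msupp (x : {malg C[option grp]})) d) ?fsubset_refl
  ?fsubsetUl ?fsubsetUr ?msuppD_le // -big_split; apply: eq_bigr => a _ /=.
rewrite -big_split; apply: eq_bigr => b _ /=.
by rewrite mcoeffD mulrDr scalerDl.
Qed.

Fact vir_lieZl a x y : vir_lie (a *: x) y = a *: vir_lie x y.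
Proof.
rewrite (vir_lieE (msuppZ_le a x) (fsubset_refl _)) /vir_lie scaler_sumr.
apply: eq_bigr => k _; rewrite scaler_sumr; apply: eq_bigr => l _.
by rewrite mcoeffZ scalerA mulrA.
Qed.

Fact vir_lieZr a x y : vir_lie x (a *: y) = a *: vir_lie x y.
Proof.
rewrite (vir_lieE (fsubset_refl _) (msuppZ_le a y)) /vir_lie scaler_sumr.
apply: eq_bigr => k _; rewrite scaler_sumr; apply: eq_bigr => l _.
by rewrite mcoeffZ scalerA mulrCA.
Qed.

Lemma vir_lie_basis (a b : option grp) :
  vir_lie << a >> << b >> = vir_basis_lie a b.
Proof.
rewrite (vir_lieE (msuppU_le) (msuppU_le)) !big_seq_fset1.
by rewrite !mcoeffUU mulr1 scale1r.
Qed.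

Lemma vir_ind (P : vir -> Prop) :
  P 0 -> (forall x y, P x -> P y -> P (x + y)) ->
  (forall a x, P x -> P (a *: x)) -> (forall k : option grp, P << k >>) ->
  forall x, P x.
Proof.
move=> P0 PD PZ Pb x; rewrite [x]monalgE.
apply: big_ind => // k _; have -> : << x@_k *g k >> = x@_k *: (<< k >> : vir).
  by apply/malgP => l; rewrite mcoeffZ !mcoeffU mulrnAr mulr1.
exact: PZ.
Qed.

Lemma vir_lie0l x : vir_lie 0 x = 0.
Proof. by have := vir_lieZl 0 0 x; rewrite !scale0r. Qed.
Lemma vir_lie0r x : vir_lie x 0 = 0.
Proof. by have := vir_lieZr 0 x 0; rewrite !scale0r. Qed.

Lemma vir_basis_lieC (a b : option grp) :
  vir_basis_lie a b = - vir_basis_lie b a.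
Proof.
case: a b => [i|] [j|] /=; rewrite ?oppr0 //.
have oppE (V : lmodType C) (s t : C) (u v : V) :
    - (s *: u + t *: v) = (- s) *: u + (- t) *: v.
  by rewrite opprD !scaleNr.
have eqE (V : lmodType C) (s s' t t' : C) (u v : V) :
    s = s' -> t = t' -> s *: u + t *: v = s' *: u + t' *: v.
  by move=> -> ->.
rewrite oppE [j + i]addrC; apply: eqE.
  by rewrite -rmorphN opprB.
rewrite -[j == - i]eqr_oppLR [- j == i]eq_sym.
case: eqP => [->|_]; last by rewrite !mul0r oppr0.
by rewrite !mul1r -rmorphN; congr (real_complex R _); rewrite /=; ring.
Qed.

Lemma vir_lieC x y : vir_lie x y = - vir_lie y x.
Proof.
elim/vir_ind: x => [|x1 x2 H1 H2|a x Hx|k].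
- by rewrite vir_lie0l vir_lie0r oppr0.
- by rewrite vir_lieDl vir_lieDr H1 H2 opprD.
- by rewrite vir_lieZl vir_lieZr Hx scalerN.
elim/vir_ind: y => [|y1 y2 H1 H2|a y Hy|l].
- by rewrite vir_lie0l vir_lie0r oppr0.
- by rewrite vir_lieDl vir_lieDr H1 H2 opprD.
- by rewrite vir_lieZl vir_lieZr Hy scalerN.
by rewrite !vir_lie_basis vir_basis_lieC.
Qed.

Fact vir_liexx x : vir_lie x x = 0.
Proof.
have oppr_eq (V : lmodType C) (v : V) : v = - v -> v = 0.
  move/eqP; rewrite -addr_eq0 -mulr2n -scaler_nat.
  by rewrite scaler_eq0 pnatr_eq0 => /eqP.
by apply: oppr_eq; exact: vir_lieC.
Qed.

Lemma vir_lie_e (i j : grp) :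
  vir_lie (vir_e i) (vir_e j) =
  real_complex R (val j - val i) *: vir_e (i + j)
  + ((i == - j)%:R * real_complex R ((val i ^+ 3 - val i) / 12%:R)) *: vir_c.
Proof. exact: (vir_lie_basis (Some i) (Some j)). Qed.

Lemma vir_lie_c x : vir_lie x vir_c = 0.
Proof.
elim/vir_ind: x => [|x1 x2 H1 H2|a x Hx|k].
- exact: vir_lie0l.
- by rewrite vir_lieDl H1 H2 addr0.
- by rewrite vir_lieZl Hx scaler0.
by rewrite vir_lie_basis; case: k.
Qed.

Lemma vir_lie_ee (i j k : grp) :
  vir_lie (vir_e i) (vir_lie (vir_e j) (vir_e k)) =
  real_complex R ((val k - val j) * (val j + val k - val i)) *: vir_e (i + j + k)
  + ((i + j + k == 0)%:R *
     real_complex R ((val k - val j) * ((val i ^+ 3 - val i) / 12%:R))) *: vir_c.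
Proof.
have distE (V : lmodType C) (s s' t t' : C) (u v : V) :
    s *: (s' *: u + t' *: v) + t *: 0 = (s * s') *: u + (s * t') *: v.
  by rewrite scaler0 addr0 scalerDr !scalerA.
refine (etrans (congr1 (vir_lie (vir_e i)) (vir_lie_e j k)) _).
refine (etrans (vir_lieDr _ _ _) _).
refine (etrans (congr2 +%R (vir_lieZr _ _ _) (vir_lieZr _ _ _)) _).
refine (etrans (congr2 +%R (congr1 ( *:%R _) (vir_lie_e i (j + k)))
                          (congr1 ( *:%R _) (vir_lie_c (vir_e i)))) _).
refine (etrans (distE _ _ _ _ _ _ _) _).
have eqE (V : lmodType C) (s s' t t' : C) (u u' v : V) :
    s = s' -> u = u' -> t = t' -> s *: u + t *: v = s' *: u' + t' *: v.
  by move=> -> -> ->.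
apply: eqE; [by rewrite -rmorphM | by rewrite addrA |].
by rewrite -addr_eq0 addrA mulrCA -rmorphM.
Qed.

Fact vir_lie_jacobi x y z :
  vir_lie x (vir_lie y z) + vir_lie y (vir_lie z x) + vir_lie z (vir_lie x y)
  = 0.
Proof.
move: x y z; pose B (x : vir) := exists k : option grp, x = << k >>.
apply: (@jacobi_generators C vir vir_lie vir_lieDl vir_lieZl vir_lieDr vir_lieZr B).
  move=> P P0 PD PZ PB; apply: vir_ind => // k; apply: PB; by exists k.
have Jc := jacobi_central vir_lieZr vir_lieC vir_lie_c.
move=> _ _ _ [k1 ->] [k2 ->] [k3 ->].
case: k1 => [i|]; last by have [+ _ _] := Jc << k2 >> << k3 >>.
case: k2 => [j|]; last by have [_ + _] := Jc << k3 >> << Some i >>.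
case: k3 => [k|]; last by have [_ _ +] := Jc << Some i >> << Some j >>.
have sumE (V : lmodType C) (s1 s2 s3 t1 t2 t3 : C) (u v : V) :
    s1 + s2 + s3 = 0 -> t1 + t2 + t3 = 0 ->
    s1 *: u + t1 *: v + (s2 *: u + t2 *: v) + (s3 *: u + t3 *: v) = 0.
  move=> s0 t0; rewrite (addrACA (s1 *: u)) -!scalerDl addrACA -!scalerDl s0 t0.
  by rewrite !scale0r addr0.
have e1 : j + k + i = i + j + k by rewrite addrC addrA.
have e2 : k + i + j = i + j + k by rewrite -addrA addrC.
suff: vir_lie (vir_e i) (vir_lie (vir_e j) (vir_e k)) +
      vir_lie (vir_e j) (vir_lie (vir_e k) (vir_e i)) +
      vir_lie (vir_e k) (vir_lie (vir_e i) (vir_e j)) = 0 by [].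
rewrite [X in X + _ + _]vir_lie_ee [X in _ + X + _]vir_lie_ee.
rewrite [X in _ + X]vir_lie_ee e1 e2.
have real0 (r : R) : r = 0 -> real_complex R r = 0.
  by move->; rewrite rmorph0.
apply: sumE; first by rewrite -!rmorphD; apply: real0; ring.
have [ijk0|_] := eqVneq (i + j + k) 0; last by rewrite !mul0r !addr0.
have vi : val i = - val j - val k.
  have h : val i + val j + val k = 0.
    by rewrite -[RHS]/(val (0 : grp)) -ijk0.
  by apply/eqP; rewrite -subr_eq0 -h; apply/eqP; ring.
rewrite !mul1r vi -!rmorphD; apply: real0.
by field.
Qed.

HB.instance Definition _ := Lmodule_isLieAlgebra.Build C vir
  vir_lieDl vir_lieZl vir_lieDr vir_lieZr vir_liexx vir_lie_jacobi.

Definition n_plus : {pred vir} :=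
  lspan (fun x : vir => exists2 i : grp, 0 < val i & x = vir_e i).

Definition cartan_gen (x : vir) : Prop := x = vir_e 0 \/ x = vir_c.
Definition cartan : Type := lspan_type cartan_gen.
HB.instance Definition _ := GRing.Lmodule.on cartan.

Definition root_vector (x : vir) : Prop :=
  exists2 a : C, a != 0 & exists2 i : grp, 0 < val i & x = a *: vir_e i.

Definition highest_weight_lmod (V : lieModType vir) : Prop :=
  exists v : V, [/\ v != 0, generates v,
    forall x, x \in n_plus -> lact x v = 0 &
    exists lambda : {scalar cartan},
      forall h : cartan, lact (lspan_val h) v = lambda h *: v].

Definition verma0_gen (u : uea vir) : Prop :=
  (exists2 x : vir, x \in n_plus & u = uea_gen x)
  \/ u = uea_gen (vir_e 0) \/ u = uea_gen vir_c.

Definition verma0 : lieModType vir := quot_lmod (left_ideal_submod verma0_gen).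

Definition L0 : lieModType vir := top_lmod verma0.

Definition verma0_epi : lieHom verma0 L0 := top_proj verma0.

Definition K0 : lieModType vir := sub_lmod (lie_ker verma0_epi).

End Virasoro.

(* Main.v *)
Require Import Defs.
From HB Require Import structures.
From mathcomp Require Import all_boot all_order all_algebra.
From mathcomp Require Import reals.
From mathcomp Require Import finmap boolp.
From mathcomp.real_closed Require Import complex.
From mathcomp.multinomials Require Import monalg.
From mathcomp Require Import ring lra.

Set Implicit Arguments.
Unset Strict Implicit.
Unset Printing Implicit Defensive.

Import Order.TTheory GRing.Theory Num.Theory.

Local Open Scope ring_scope.

(** A subgroup [G] as in the theorem is dense in the real line. Write [v] for
    the highest weight vector of M(0) and [A] for the span of the nonempty words
    [e_(a_1) ... e_(a_n) v] with all [a_i < 0].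

    The nonnegative part of Vir_G acts on the free associative algebra on the
    [e_a], [a < 0], by moving letters to the right; modulo the relations of
    U(n_-) this is a module for Vir_G, and it shows that [v] is not in [A] and
    that [e_a v <> 0]. Hence [A] is the only maximal submodule, L(0) is trivial
    and K(0) = [A]; linear independence of the PBW monomials is not needed.

    Let [w] be a nonzero element of [A] lying in a subspace [S] stable under the
    [e_i], [i >= 0]. One may take [w] homogeneous, and of minimal length [r],
    words being taken up to reordering and shorter words. If [a] is the lowest
    letter in the top part of [w] and [j] is slightly smaller than [-a], then
    [e_j] replaces [a] by the tiny letter [a + j] and shortens every word
    through its other letters. After [r] such steps the top part is a single
    monomial [x e_(d_1) ... e_(d_r) v], of weight [m]. For [k] slightly smaller
    than [-m], [e_k] must absorb all letters of every word, so [e_k w] equals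
    [Q(k) e_(k+m) v] for a polynomial [Q] of degree exactly [r], and density
    provides a [k] with [Q(k) <> 0]. So [S] contains some [e_i v], [i < 0].

    Each [e_i v], [i < 0], generates [A], which is therefore simple; and a
    singular vector of [A] would be a multiple of some [e_i v], which is moved
    to a nonzero vector by [e_j] for [0 < j < -i]. *)

(** * Linear identities in a module, by reflection *)

Section LinearExpressions.
Variables (K : fieldType) (V : lmodType K).

Inductive lexpr :=
  LAtom of nat | LZero | LAdd of lexpr & lexpr | LOpp of lexpr | LScale of K & lexpr.

Fixpoint leval (env : seq V) e : V :=
  match e with
  | LAtom i => nth 0 env i
  | LZero => 0
  | LAdd e1 e2 => leval env e1 + leval env e2
  | LOpp e1 => - leval env e1
  | LScale a e1 => a *: leval env e1
  end.

Fixpoint lcoef i e : K :=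
  match e with
  | LAtom j => if i == j then 1 else 0
  | LZero => 0
  | LAdd e1 e2 => lcoef i e1 + lcoef i e2
  | LOpp e1 => - lcoef i e1
  | LScale a e1 => a * lcoef i e1
  end.

(** A conjunction instead of a bounded quantifier, so that it computes to one scalar goal per
    atom. *)
Fixpoint lcoef_eq n e1 e2 : Prop :=
  if n is m.+1 then lcoef m e1 = lcoef m e2 /\ lcoef_eq m e1 e2 else True.

Lemma leval_lcoef (env : seq V) e :
  leval env e = \sum_(i < size env) lcoef i e *: env`_i.
Proof.
elim: e => [j||e1 IH1 e2 IH2|e1 IH1|a e1 IH1] /=.
- have [sj|js] := leqP (size env) j.
    rewrite nth_default // big1 // => i _; case: eqP => [ij|_]; rewrite ?scale0r //.
    by have := ltn_ord i; rewrite ij ltnNge sj.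
  rewrite (bigD1 (Ordinal js)) //= eqxx scale1r big1 ?addr0 // => i.
  by rewrite -val_eqE /= => /negPf ->; rewrite scale0r.
- by rewrite big1 // => i _; rewrite scale0r.
- by rewrite IH1 IH2 -big_split; apply: eq_bigr => i _; rewrite scalerDl.
- by rewrite IH1 -sumrN; apply: eq_bigr => i _; rewrite scaleNr.
- by rewrite IH1 scaler_sumr; apply: eq_bigr => i _; rewrite scalerA.
Qed.

Lemma leval_eq (env : seq V) e1 e2 :
  lcoef_eq (size env) e1 e2 -> leval env e1 = leval env e2.
Proof.
rewrite !leval_lcoef; elim: (size env) => [|n IH] /= => [_|[eqn /IH IHn]].
  by rewrite !big_ord0.
by rewrite !big_ord_recr /= IHn eqn.
Qed.
End LinearExpressions.

(** Falling back on [unify] lets convertible presentations of one vector share an index. *)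
Ltac lmod_index t env :=
  lazymatch env with
  | cons ?x ?env' => match constr:(x) with
      | ?y => let _ := match goal with _ => first [constr_eq y t | unify y t] end in constr:(O)
      | _ => let n := lmod_index t env' in constr:(S n)
      end
  end.
Ltac lmod_mem t env :=
  lazymatch env with
  | nil => constr:(false)
  | cons ?x ?env' => match constr:(x) with
      | ?y => let _ := match goal with _ => first [constr_eq y t | unify y t] end in constr:(true)
      | _ => lmod_mem t env'
      end
  end.
Ltac lmod_atoms t env :=
  lazymatch t with
  | @Algebra.add _ ?a ?b => let env' := lmod_atoms a env in lmod_atoms b env'
  | @Algebra.opp _ ?a => lmod_atoms a env
  | @GRing.scale _ _ _ ?a => lmod_atoms a env
  | @Algebra.zero _ => env
  | _ => let b := lmod_mem t env in
         lazymatch b with true => env | false => constr:(cons t env) end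
  end.
Ltac lmod_reify K t env :=
  lazymatch t with
  | @Algebra.add _ ?a ?b =>
      let a' := lmod_reify K a env in let b' := lmod_reify K b env in
      constr:(LAdd a' b')
  | @Algebra.opp _ ?a => let a' := lmod_reify K a env in constr:(LOpp a')
  | @GRing.scale _ _ ?c ?a => let a' := lmod_reify K a env in constr:(@LScale K c a')
  | @Algebra.zero _ => constr:(@LZero K)
  | _ => let n := lmod_index t env in constr:(@LAtom K n)
  end.
(* Decides linear identities in an [lmodType] by comparing the coefficients of
   each atom; the scalar identities are left to the user. *)
Ltac lmod_coefs K V :=
  lazymatch goal with |- @eq ?T ?x ?y =>
    let env0 := lmod_atoms x constr:(@nil T) in
    let env := lmod_atoms y env0 in
    let e1 := lmod_reify K x env in
    let e2 := lmod_reify K y env in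
    refine (@leval_eq K V env e1 e2 _); cbn [lcoef_eq lcoef size eq_op];
    repeat split
  end.

Lemma mem_congr (T : Type) (S : {pred T}) x y : x \in S -> y = x -> y \in S.
Proof. by move=> xS ->. Qed.

(** * Induction on linear spans and linear extension from a basis *)

Section Span.
Variables (K : fieldType) (V : lmodType K).
Implicit Types (X : V -> Prop) (P : V -> Prop).

Lemma mem_lspan X u : X u -> u \in lspan X.
Proof. by move=> Xu; apply/asboolP => S; apply. Qed.

(** The span is the intersection of all subspaces containing [X], and [P] cuts out one of them. *)
Lemma lspan_ind X P : P 0 -> (forall a u v, P u -> P v -> P (a *: u + v)) ->
  (forall u, X u -> P u) -> forall v, v \in lspan X -> P v.
Proof.
move=> P0 PD PX v /asboolP Hv.
pose Q : {pred V} := fun u => `[< P u >].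
have Qsub : submod_closed Q.
  by split=> [|a u w /asboolP Pu /asboolP Pw]; apply/asboolP => //; exact: PD.
pose QM := GRing.isSubmodClosed.Build K V Q Qsub.
pose QS : submodClosed V := HB.pack Q QM.
by have /asboolP := Hv QS (fun u Xu => introT (asboolP _) (PX u Xu)).
Qed.

Lemma lin0 (W : lmodType K) (f : V -> W) : linear f -> f 0 = 0.
Proof. by move=> fl; have := fl (-1) 0 0; rewrite scaleN1r oppr0 addr0 scaleN1r addNr. Qed.

Lemma lspan_op (W : lmodType K) (f : V -> W) X (S : submodClosed W) : linear f ->
  (forall u, X u -> f u \in S) -> forall v, v \in lspan X -> f v \in S.
Proof.
move=> fl fS; apply: lspan_ind => // [|a u v Su Sv]; first by rewrite (lin0 fl) rpred0.
by rewrite fl rpredD ?rpredZ.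
Qed.

End Span.

Section LinearExtension.
Variables (K : fieldType) (X : choiceType) (V : lmodType K) (f : X -> V).
Implicit Type t : {malg K[X]}.

Definition mext t : V := \sum_(x <- msupp t) t@_x *: f x.

Lemma mextEw (d : {fset X}) t : (msupp t `<=` d)%fset ->
  mext t = \sum_(x <- d) t@_x *: f x.
Proof.
move=> sd; rewrite /mext (big_fset_incl _ sd) // => x _ /mcoeff_outdom ->.
by rewrite scale0r.
Qed.

Fact mext_linear : linear mext.
Proof.
move=> a t u; pose d := (msupp t `|` msupp u)%fset.
have sd : (msupp (a *: t + u) `<=` d)%fset.
  by apply: fsubset_trans (msuppD_le _ _) _; rewrite fsetSU ?msuppZ_le.
rewrite (mextEw sd) !(@mextEw d) ?fsubsetUl ?fsubsetUr //.
rewrite scaler_sumr -big_split; apply: eq_bigr => x _ /=.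
by rewrite mcoeffD mcoeffZ scalerDl scalerA.
Qed.
HB.instance Definition _ :=
  GRing.isLinear.Build K {malg K[X]} V _ mext mext_linear.

Lemma mextU x : mext << x >> = f x.
Proof. by rewrite (mextEw msuppU_le) big_seq_fset1 mcoeffUU scale1r. Qed.

End LinearExtension.

Section MalgInduction.
Variables (K : fieldType) (X : choiceType).

Lemma malgUZ (a : K) (x : X) : << a *g x >> = a *: (<< x >> : {malg K[X]}).
Proof. by apply/malgP => y; rewrite mcoeffZ !mcoeffU mulrnAr mulr1. Qed.

Lemma malg_sum (t : {malg K[X]}) : t = \sum_(x <- msupp t) t@_x *: << x >>.
Proof. by rewrite {1}[t]monalgE; apply: eq_bigr => x _; rewrite malgUZ. Qed.

Lemma malg_ind (P : {malg K[X]} -> Prop) :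
  P 0 -> (forall a u v, P u -> P v -> P (a *: u + v)) ->
  (forall x, P << x >>) -> forall t, P t.
Proof.
move=> P0 PD PU t; rewrite [t]malg_sum; elim: (enum_fset _) => [|x s IH].
  by rewrite big_nil.
by rewrite big_cons; apply: PD.
Qed.

End MalgInduction.

(** * The Verma module *)

Section FreeAction.
Variables (K : fieldType) (g : zmodType) (c : {additive g -> K}) (neg : pred g).
Hypothesis negD : forall a b, neg a -> neg b -> neg (a + b).
Hypothesis nnegD : forall a b, ~~ neg a -> ~~ neg b -> ~~ neg (a + b).
(* The free vector space on words, used only through its universal property. *)
Variables (T : lmodType K) (fw : seq g -> T).
Variable fext : forall V : lmodType K, (seq g -> V) -> {linear T -> V}.
Hypothesis fextU : forall (V : lmodType K) (f : seq g -> V) w, fext f (fw w) = f w.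
Hypothesis fw_ind : forall P : T -> Prop, P 0 ->
  (forall a u v, P u -> P v -> P (a *: u + v)) -> (forall w, P (fw w)) -> forall t, P t.
Implicit Types (i j y z a b : g) (w u : seq g) (t : T).

Definition fcons y : T -> T := fext (fun w => fw (y :: w)).
HB.instance Definition _ y := GRing.Linear.on (fcons y).

Let fconsD y t t' : fcons y (t + t') = fcons y t + fcons y t'.
Proof. exact: linearD. Qed.
Let fconsN y t : fcons y (- t) = - fcons y t.
Proof. exact: linearN. Qed.
Let fconsZ y (d : K) t : fcons y (d *: t) = d *: fcons y t.
Proof. exact: linearZ. Qed.

Lemma fconsU y w : fcons y (fw w) = fw (y :: w).
Proof. exact: fextU. Qed.

(** A nonnegative letter is moved to the right by [e_i, e_y] = (y - i) e_(i+y) and dies on the empty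
    word, which stands for the highest weight vector. A negative letter is merely put in front, so
    no relation between negative letters is imposed. *)
Fixpoint free_act_word i w : T :=
  match w with
  | [::] => if neg i then fw ([:: i]) else 0
  | y :: w' => if neg i then fw (i :: w)
      else fcons y (free_act_word i w') + (c y - c i) *: free_act_word (i + y) w'
  end.

Definition free_act i : T -> T := fext (free_act_word i).
HB.instance Definition _ i := GRing.Linear.on (free_act i).

Lemma free_actU i w : free_act i (fw w) = free_act_word i w.
Proof. exact: fextU. Qed.

Let free_actD i t t' : free_act i (t + t') = free_act i t + free_act i t'.
Proof. exact: linearD. Qed.
Let free_actN i t : free_act i (- t) = - free_act i t.
Proof. exact: linearN. Qed.
Let free_actZ i (d : K) t : free_act i (d *: t) = d *: free_act i t.
Proof. exact: linearZ. Qed.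
Let linE := (fconsD, fconsN, fconsZ, free_actD, free_actN, free_actZ).

Lemma free_act_neg i t : neg i -> free_act i t = fcons i t.
Proof.
move=> i0; elim/fw_ind: t => [|d u v Hu Hv|w]; rewrite ?raddf0 //.
  by rewrite !linE Hu Hv.
rewrite fconsU free_actU.
by case: w => [|y w] /=; rewrite i0.
Qed.

Let cD a b : c (a + b) = c a + c b. Proof. exact: raddfD. Qed.

Ltac malg_ring := rewrite ?linE;
  lmod_coefs K T; rewrite /= ?cD; ring.

Lemma free_act_cons i y t : ~~ neg i ->
  free_act i (fcons y t) = fcons y (free_act i t) + (c y - c i) *: free_act (i + y) t.
Proof.
move=> i0; elim/fw_ind: t => [|d u v Hu Hv|w].
- by rewrite !raddf0 ?scaler0 addr0.
- by rewrite !linE Hu Hv; malg_ring.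
- by rewrite fconsU !free_actU /= (negPf i0).
Qed.

Lemma free_act_nil i : ~~ neg i -> free_act i (fw [::]) = 0.
Proof. by move=> /negPf i0; rewrite free_actU /= i0. Qed.

(** The context [u], [w] is arbitrary, which makes the span stable under putting letters in
    front. *)
Definition nrel_gen (t : T) : Prop := exists u a b w, [/\ neg a, neg b &
  t = fw (u ++ a :: b :: w) - fw (u ++ b :: a :: w)
      - (c b - c a) *: fw (u ++ (a + b) :: w)].
Local Notation J := (lspan nrel_gen).

Lemma fcons_nrel y t : t \in J -> fcons y t \in J.
Proof.
apply: lspan_op => [|_ [u [a [b [w [a0 b0 ->]]]]]]; first exact: linearP.
rewrite !linE.
by rewrite !fconsU; apply: mem_lspan; exists (y :: u), a, b, w.
Qed.

Lemma fcons_comm a b t : neg a -> neg b ->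
  fcons a (fcons b t) - fcons b (fcons a t) - (c b - c a) *: fcons (a + b) t \in J.
Proof.
move=> a0 b0; elim/fw_ind: t => [|d u v Hu Hv|w].
- by rewrite !raddf0 ?(scaler0, addr0, subr0) rpred0.
- apply: (mem_congr (rpredD (rpredZ d Hu) Hv)).
  by malg_ring.
by rewrite !fconsU; apply: mem_lspan; exists [::], a, b, w.
Qed.

(** For nonnegative [i] the identity is exact, being the recursive clause of the action; for
    negative [i] it is one of the relations. *)
Lemma free_act_consJ i b t : neg b ->
  free_act i (fcons b t) - fcons b (free_act i t)
    - (c b - c i) *: free_act (i + b) t \in J.
Proof.
move=> b0; have [i0|i0] := boolP (neg i); last first.
  by rewrite free_act_cons // -addrA -opprD subrr rpred0.
by rewrite !free_act_neg ?fcons_comm ?negD.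
Qed.

(** Lets the action descend to the quotient by the relations. The induction is on the prefix [u];
    letters are peeled off until [e_i] meets the relation itself. *)
Lemma free_act_nrel i t : t \in J -> free_act i t \in J.
Proof.
apply: lspan_op => [|_ [u [a [b [w [a0 b0 ->]]]]]]; first exact: linearP.
elim: u i => [|y u IH] i; have [i0|i0] := boolP (neg i) => /=.
- by rewrite free_act_neg // fcons_nrel //; apply: mem_lspan; exists [::], a, b, w.
- have acti y t := @free_act_cons i y t i0.
  pose X : T := fw w.
  have fcX y z : fw (y :: z :: w) = fcons y (fcons z X) by rewrite !fconsU.
  rewrite !fcX -[fw ((a + b) :: w)]fconsU -/X !linE; clear fcX; move: X => X.
  rewrite !acti.
  have Ha := free_act_consJ (i + b) X a0; have Hb := free_act_consJ (i + a) X b0.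
  have Hc := fcons_comm (free_act i X) a0 b0.
  rewrite [i + b + a]addrAC in Ha; rewrite [i + (a + b)]addrA.
  set k := i + a + b in Ha Hb *; have ck : c k = c i + c a + c b by rewrite /k !cD.
  clearbody k.
  (* The Jacobi identity for [i], [a], [b]: the relation on [e_i X], corrected by the brackets of
     [a] with [i + b] and of [b] with [i + a]. *)
  apply: mem_congr (rpredD Hc (rpredB (rpredZ (c a - c i) Hb)
    (rpredZ (c b - c i) Ha))) _.
  rewrite ?linE; lmod_coefs K T; rewrite /= ?ck ?cD; ring.
- by rewrite free_act_neg // fcons_nrel //; apply: mem_lspan; exists (y :: u), a, b, w.
- set x : T := fw (u ++ a :: b :: w) - fw (u ++ b :: a :: w)
      - (c b - c a) *: fw (u ++ (a + b) :: w).
  have -> : fw (y :: u ++ a :: b :: w) - fw (y :: u ++ b :: a :: w)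
      - (c b - c a) *: fw (y :: u ++ (a + b) :: w) = fcons y x.
    by rewrite /x !linE !fconsU.
  have IHx k : free_act k x \in J by exact: IH.
  have Jx : x \in J by apply: mem_lspan; exists u, a, b, w.
  clearbody x.
  by rewrite free_act_cons // rpredD ?rpredZ ?fcons_nrel.
Qed.

(** Induction on the word with [i] and [j] arbitrary, since passing a letter [z] replaces them by
    [i + z] and [j + z], which may have either sign. *)
Lemma free_act_lieJ i j t :
  free_act i (free_act j t) - free_act j (free_act i t)
    - (c j - c i) *: free_act (i + j) t \in J.
Proof.
have negJ k l t' : neg l -> free_act k (free_act l t') - free_act l (free_act k t')
    - (c l - c k) *: free_act (k + l) t' \in J.
  by move=> l0; rewrite ![free_act l _]free_act_neg // free_act_consJ.
elim/fw_ind: t i j => [|d u v Hu Hv|w] i j.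
- by rewrite !raddf0 ?(scaler0, addr0, subr0) rpred0.
- have H := rpredD (rpredZ d (Hu i j)) (Hv i j); apply: (mem_congr H).
  by malg_ring.
elim: w i j => [|z w IH] i j; (have [j0|j0] := boolP (neg j); first exact: negJ);
  (have [i0|i0] := boolP (neg i);
     first by (rewrite -rpredN; apply: (mem_congr (negJ j i _ i0));
       rewrite [j + i]addrC; malg_ring)).
- by rewrite !free_act_nil ?nnegD // !raddf0 !addr0 rpred0.
rewrite -fconsU; set X : T := fw w.
have acti y t := @free_act_cons i y t i0; have actj y t := @free_act_cons j y t j0.
have actij y t := @free_act_cons (i + j) y t (nnegD i0 j0).
have := IH i j; have := IH (i + z) j; have := IH i (j + z).
rewrite -/X [i + z + j]addrAC [i + (j + z)]addrA => H1 H2 H3.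
rewrite !(acti, actj, actij, linE).
apply: mem_congr (rpredD (fcons_nrel z H3) (rpredD (rpredZ (c z - c i) H2)
  (rpredZ (c z - c j) H1))) _.
by malg_ring.
Qed.

Lemma nrel_functional (f : {linear T -> K^o}) :
  (forall u a b w, f (fw (u ++ a :: b :: w)) - f (fw (u ++ b :: a :: w)) =
     (c b - c a) * f (fw (u ++ (a + b) :: w))) ->
  forall t, t \in J -> f t = 0.
Proof.
move=> fJ; apply: lspan_ind => [|d u v Hu Hv|_ [u [a [b [w [a0 b0 ->]]]]]].
- exact: raddf0.
- by rewrite linearP /= Hu Hv scaler0 addr0.
- by rewrite !linearB linearZ /= fJ subrr.
Qed.

Definition nil_coef : T -> K^o := fext (fun w => (w == [::])%:R : K^o).
HB.instance Definition _ := GRing.Linear.on nil_coef.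

Lemma nil_coefU w : nil_coef (fw w) = (w == [::])%:R.
Proof. exact: fextU. Qed.

(** No relation involves the empty word. This is what separates the highest weight vector from the
    nonempty words. *)
Lemma nil_coef_nrel t : t \in J -> nil_coef t = 0.
Proof.
apply: nrel_functional => u a b w; rewrite /= !nil_coefU.
by case: u => [|? ?]; rewrite subrr mulr0.
Qed.

(* The coefficient of a word acting on the module with basis [f_k], [k] in
   [1 + g], where [e_i f_k = k f_(k+i)], applied to [f_1]. *)
Fixpoint word_coef w : K :=
  if w is y :: w' then (1 + c (\sum_(z <- w') z)) * word_coef w' else 1.

(** [word_coef] respects the relations and takes the value 1 on a word of one letter. *)
Lemma letter_notin_nrel a : fw [:: a] \notin J.
Proof.
pose f : {linear T -> K^o} := fext (word_coef : seq g -> K^o).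
have fE w : f (fw w) = word_coef w by exact: fextU.
apply/negP => aJ; suff : f (fw [:: a]) = 0.
  by rewrite fE /= big_nil raddf0 addr0 mulr1 => /eqP; rewrite oner_eq0.
apply: nrel_functional aJ => u b d w; rewrite !fE.
elim: u => [|y u IH] /=.
  by rewrite !big_cons !cD; ring.
rewrite !big_cat !big_cons /= [b + (d + _)]addrCA.
rewrite -mulrBr IH mulrCA; congr (_ * (_ * _)).
by rewrite !cD; ring.
Qed.

End FreeAction.

(** * Enveloping algebras and actions that are Lie actions only modulo a subspace *)

Section UeaAction.
Variables (K : fieldType) (L : lieAlgType K) (V : lmodType K) (act : L -> V -> V).
Variable J : submodClosed V.
Hypothesis act_linear : forall x, linear (act x).
Hypothesis act_linearl : forall v, linear (act^~ v).
Hypothesis actJ : forall x v, v \in J -> act x v \in J.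
Hypothesis act_lieJ : forall x y v,
  act (lie x y) v - (act x (act y v) - act y (act x v)) \in J.
Local Notation F := (free_alg K L).
Implicit Types (f h : F) (v : V).

Definition lie_defect x y v := act (lie x y) v - (act x (act y v) - act y (act x v)).

Lemma lie_defectPl a x1 x2 y v :
  lie_defect (a *: x1 + x2) y v = a *: lie_defect x1 y v + lie_defect x2 y v.
Proof.
have actl b z1 z2 u : act (b *: z1 + z2) u = b *: act z1 u + act z2 u.
  exact: act_linearl.
rewrite /lie_defect lieDl lieZl !actl act_linear; lmod_coefs K V; ring.
Qed.

Lemma lie_defectPr a x y1 y2 v :
  lie_defect x (a *: y1 + y2) v = a *: lie_defect x y1 v + lie_defect x y2 v.
Proof.
have actl b z1 z2 u : act (b *: z1 + z2) u = b *: act z1 u + act z2 u.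
  exact: act_linearl.
rewrite /lie_defect lieDr lieZr !actl act_linear; lmod_coefs K V; ring.
Qed.

Definition word_act v (m : {fmonom L}) : V := foldr act v m.

(** The free algebra acts on [V] itself; the enveloping algebra would act only on the quotient by
    [J]. *)
Definition free_alg_act f v : V := mext (word_act v) f.

Lemma free_alg_actP v : linear (free_alg_act^~ v).
Proof. exact: mext_linear. Qed.

Lemma word_act_linear m : linear (word_act^~ m).
Proof.
move=> a v w; rewrite /word_act; elim: (fmonom_val m) => [//|x s IH] /=.
by rewrite IH act_linear.
Qed.

Lemma free_alg_act_linear f : linear (free_alg_act f).
Proof.
move=> a v w; rewrite /free_alg_act /mext scaler_sumr -big_split.
by apply: eq_bigr => m _ /=; rewrite word_act_linear scalerDr !scalerA mulrC.
Qed.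

Lemma free_alg_actU m v : free_alg_act << m >> v = word_act v m.
Proof. exact: mextU. Qed.

Lemma free_alg_actM f h v : free_alg_act (f * h) v = free_alg_act f (free_alg_act h v).
Proof.
elim/(@malg_ind K {fmonom L}): f => [|a f1 f2 H1 H2|m].
- by rewrite mul0r (lin0 (free_alg_actP v)) (lin0 (free_alg_actP _)).
- by rewrite mulrDl -scalerAl !free_alg_actP; congr (_ *: _ + _).
elim/(@malg_ind K {fmonom L}): h => [|a f1 f2 H1 H2|n].
- by rewrite mulr0 (lin0 (free_alg_actP _)) (lin0 (free_alg_act_linear _)).
- by rewrite mulrDr -scalerAr !free_alg_actP free_alg_act_linear; congr (_ *: _ + _).
rewrite !free_alg_actU malgM_def fgmulUU mulr1 free_alg_actU /word_act.
by rewrite fmM foldr_cat.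
Qed.

Lemma free_alg_actJ f v : v \in J -> free_alg_act f v \in J.
Proof.
move=> vJ; rewrite /free_alg_act /mext rpred_sum // => m _; rewrite rpredZ //.
by rewrite /word_act; elim: (fmonom_val m) => [//|x s IH] /=; apply: actJ.
Qed.

(** The elements sending all of [V] into [J] form a two-sided ideal: a left one because [J] is
    stable, a right one because all vectors are allowed. It contains the defining relations. *)
Lemma uea_ideal_act f : f \in @uea_ideal K L -> forall v, free_alg_act f v \in J.
Proof.
pose I : {pred F} := fun f => `[< forall v, free_alg_act f v \in J >].
have genE x v : free_alg_act (free_gen K x) v = act x v.
  by rewrite /free_gen free_alg_actU /word_act fmU.
have actB f1 f2 v : free_alg_act (f1 - f2) v = free_alg_act f1 v - free_alg_act f2 v.
  by rewrite -[- f2]scaleN1r [f1 + _]addrC free_alg_actP scaleN1r addrC.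
have actD f1 f2 v : free_alg_act (f1 + f2) v = free_alg_act f1 v + free_alg_act f2 v.
  by rewrite -[X in X + f2]scale1r free_alg_actP scale1r.
move=> /asboolP/(_ I) fI v; suff /asboolP : f \in I by apply.
apply: fI.
  split; [split; [split|]|] => [|a p q /asboolP Hp /asboolP Hq|a p /asboolP Hp|a p /asboolP Hp];
    apply/asboolP => w.
  - by rewrite (lin0 (free_alg_actP _)) rpred0.
  - by rewrite free_alg_actP rpredD ?rpredZ.
  - by rewrite free_alg_actM free_alg_actJ.
  - by rewrite free_alg_actM.
move=> _ [x y|a x|x y]; apply/asboolP => w; rewrite ?actB ?actD.
- have := act_linearl w 1 x y; rewrite /= !scale1r !genE => ->.
  by rewrite subrr rpred0.
- have actZ := free_alg_actP w a (free_gen K x) 0.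
  have := act_linearl w a x 0.
  rewrite /= !addr0 (lin0 (act_linearl _)) addr0 in actZ *.
  move=> aE; rewrite genE aE; move: actZ.
  by rewrite (lin0 (free_alg_actP _)) addr0 genE => ->; rewrite subrr rpred0.
- have actM y1 y2 : free_alg_act (free_gen K y1 * free_gen K y2) w = act y1 (act y2 w).
    by rewrite free_alg_actM (genE y2) (genE y1).
  have := rpredZ (-1) (act_lieJ x y w); rewrite scaleN1r opprB.
  by congr (_ \in J); congr (_ - _ - _); rewrite ?genE ?actM.
Qed.

(** Having one representative that sends [v0] into [J] defines a left ideal. Any other
    representative then does the same, as the two differ by an element of [uea_ideal]. *)
Lemma left_ideal_gen_act (X : uea L -> Prop) v0 :
  (forall q, X q -> exists2 f, q = uea_proj f & free_alg_act f v0 \in J) ->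
  forall f, uea_proj f \in left_ideal_gen X -> free_alg_act f v0 \in J.
Proof.
move=> XJ f.
pose I : {pred uea L} := fun q => `[< exists2 f, q = uea_proj f & free_alg_act f v0 \in J >].
move=> /asboolP/(_ I) fI; have /asboolP [h /eqP] : uea_proj f \in I.
  apply: fI => [|q /XJ Hq]; last exact/asboolP.
  split; [split|] => [|a p q /asboolP [f1 -> H1] /asboolP [f2 -> H2]|a q /asboolP [f1 -> H1]];
    apply/asboolP.
  - exists 0; last by rewrite (lin0 (free_alg_actP _)) rpred0.
    rewrite /uea_proj; apply/esym.
    exact: (raddf0 (\pi_(Quotient.quot (@uea_ideal K L)))%qT).
  - exists (a *: f1 + f2); first by rewrite uea_projD -uea_projZ.
    by rewrite free_alg_actP rpredD ?rpredZ.
  - elim/uea_ind: a => a; exists (a * f1); first by rewrite /GRing.mul /= uea_projM.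
    by rewrite free_alg_actM free_alg_actJ.
rewrite uea_projE => /uea_ideal_act fh hJ.
have -> : f = (f - h) + h by rewrite subrK.
by rewrite -[f - h]scale1r free_alg_actP scale1r rpredD.
Qed.

End UeaAction.

(** * Indices in G and the bracket of Vir_G *)

Section VirasoroIndex.
Variables (R : realType) (G : zmodClosed R).
Local Notation C := (complex R).
Local Notation g := (grp G).

Definition idx (i : g) : C := real_complex R (val i).

Fact idx_zmod_morphism : zmod_morphism idx.
Proof. by move=> i j; rewrite /idx -rmorphB. Qed.
HB.instance Definition _ := GRing.isZmodMorphism.Build g C idx idx_zmod_morphism.

Lemma idx_eq0 i : (idx i == 0) = (val i == 0).
Proof. by rewrite /idx fmorph_eq0. Qed.

Lemma grp_valD (i j : g) : val (i + j) = val i + val j. Proof. by []. Qed.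
Lemma grp_valN (i : g) : val (- i) = - val i. Proof. by []. Qed.
Lemma grp_val0 : val (0 : g) = 0. Proof. by []. Qed.

Definition neg_idx : pred g := fun i => val i < 0.

Lemma neg_idxD a b : neg_idx a -> neg_idx b -> neg_idx (a + b).
Proof. rewrite /neg_idx grp_valD => a0 b0; lra. Qed.
Lemma nneg_idxD a b : ~~ neg_idx a -> ~~ neg_idx b -> ~~ neg_idx (a + b).
Proof. rewrite /neg_idx -!leNgt grp_valD => a0 b0; lra. Qed.

Lemma lie_e (i j : g) : lie (vir_e i) (vir_e j) = (idx j - idx i) *: vir_e (i + j)
  + ((i == - j)%:R * real_complex R ((val i ^+ 3 - val i) / 12%:R)) *: vir_c G.
Proof. by rewrite -[idx j - idx i]raddfB /idx; exact: vir_lie_e. Qed.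

Lemma lie_c (x : vir G) : lie x (vir_c G) = 0.
Proof. exact: vir_lie_c. Qed.

Lemma vir_lin_ind (P : vir G -> Prop) : P 0 ->
  (forall (a : C) (x y : vir G), P x -> P y -> P (a *: x + y)) ->
  (forall i, P (vir_e i)) -> P (vir_c G) -> forall x, P x.
Proof.
by move=> P0 PD Pe Pc; apply: (@malg_ind C (option g) P) => // -[i|] //; apply: Pe.
Qed.

Definition vword (V : lieModType (vir G)) (v : V) (s : seq g) : V :=
  foldr (fun i => lact (vir_e i)) v s.

End VirasoroIndex.

(** * Comparison of M(0) with the action on words *)

Section Verma.
Variables (R : realType) (G : zmodClosed R).
Local Notation C := (complex R).
Local Notation g := (grp G).
Local Notation M := (verma0 G).
Local Notation idx := (@idx R G).
Local Notation neg := (@neg_idx R G).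

Definition verma0_vec : M := quot_proj _ (1 : uea (vir G)).
Local Notation v0 := verma0_vec.

Lemma lact_quot_proj (L : lieAlgType C) (V : lieModType L) (S : lieSubmod V) x w :
  lact x (quot_proj S w : quot_lmod S) = quot_proj S (lact x w).
Proof. exact: quot_proj_lact. Qed.

Lemma lact_uea_proj (L : lieAlgType C) (S : lieSubmod (uea L)) x f :
  lact x (quot_proj S (uea_proj f) : quot_lmod S) =
  quot_proj S (uea_proj (free_gen C x * f)).
Proof.
have E : lact x (uea_proj f : uea L) = uea_proj (free_gen C x * f).
  by rewrite /lact /= /uea_lact /GRing.mul /= /uea_gen uea_projM.
exact: etrans (quot_proj_lact S x _) (congr1 (quot_proj S) E).
Qed.

Lemma lact_verma0_vec x : lact x v0 = quot_proj _ (uea_gen x).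
Proof. by rewrite /verma0_vec lact_quot_proj /lact /= /uea_lact mulr1. Qed.

Lemma quot_proj_eq0 (L : lieAlgType C) (V : lieModType L) (S : lieSubmod V) w :
  quot_proj S w = 0 <-> w \in S.
Proof.
rewrite -[0 in X in X <-> _](raddf0 (@quot_proj _ _ _ S)).
by split=> [/eqP|H]; [|apply/eqP]; rewrite quot_projE subr0.
Qed.

Lemma verma0_vec_gen x : verma0_gen (uea_gen x) -> lact x v0 = 0.
Proof.
move=> Hx; rewrite lact_verma0_vec quot_proj_eq0.
by apply/asboolP => I _; apply.
Qed.

Lemma verma0_vec_e i : 0 <= val (i : g) -> lact (vir_e i) v0 = 0.
Proof.
rewrite le_eqVlt => /orP[/eqP i0|i0]; apply: verma0_vec_gen; last first.
  by left; exists (vir_e i) => //; apply: mem_lspan; exists i.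
by right; left; congr (uea_gen (vir_e _)); apply: val_inj.
Qed.

Lemma verma0_vec_c : lact (vir_c G) v0 = 0.
Proof. by apply: verma0_vec_gen; right; right. Qed.

Lemma verma0_generates : generates v0.
Proof.
move=> S v0S; elim/quot_ind => q; elim/uea_ind: q => u.
elim/(@malg_ind C {fmonom vir G}): u => [|a u1 u2 H1 H2|m].
- suff -> : quot_proj (left_ideal_submod (@verma0_gen R G)) (uea_proj 0) = 0 by exact: rpred0.
  rewrite /uea_proj (raddf0 (\pi_(Quotient.quot (@uea_ideal C (vir G))))%qT).
  exact: (raddf0 (@quot_proj _ _ _ _)).
- by rewrite uea_projD -uea_projZ quot_projD quot_projZE rpredD ?rpredZ.
rewrite -[m]fmK; elim: (fmonom_val m) => [|x s IH].
  suff -> : uea_proj << FMonom [::] >> = 1 :> uea (vir G) by [].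
  by rewrite -fmoneE.
suff -> : uea_proj << FMonom (x :: s) >> = uea_gen x * uea_proj << FMonom s >>.
  by have := lact_closed x IH; rewrite lact_quot_proj.
rewrite /GRing.mul /= /uea_gen uea_projM /free_gen; congr uea_proj.
by rewrite malgM_def fgmulUU mulr1; congr << _ >>; apply/eqP; rewrite fmP fmM fmU.
Qed.

Variables (T : lmodType C) (fw : seq g -> T).
Variable fext : forall V : lmodType C, (seq g -> V) -> {linear T -> V}.
Hypothesis fextU : forall (V : lmodType C) (f : seq g -> V) w, fext f (fw w) = f w.
Hypothesis fw_ind : forall P : T -> Prop, P 0 ->
  (forall a u v, P u -> P v -> P (a *: u + v)) -> (forall w, P (fw w)) -> forall t, P t.

Local Notation fact := (free_act idx neg fw fext).
Local Notation J := (lspan (nrel_gen idx neg fw)).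

(** The central element acts by zero, as it does on M(0), so only the bracket without its central
    term has to be respected. *)
Definition vir_act (x : vir G) (t : T) : T :=
  mext (fun k => if k is Some i then fact i t else 0) x.

Lemma vir_act_linear x : linear (vir_act x).
Proof.
move=> a t u; rewrite /vir_act /mext scaler_sumr -big_split.
apply: eq_bigr => -[i|] _ /=; last by rewrite !scaler0 addr0.
by rewrite linearP scalerDr !scalerA mulrC.
Qed.

Lemma vir_act_linearl t : linear (vir_act^~ t).
Proof. exact: mext_linear. Qed.

Lemma vir_act_e i t : vir_act (vir_e i) t = fact i t.
Proof. exact: mextU. Qed.
Lemma vir_act_c t : vir_act (vir_c G) t = 0.
Proof. exact: mextU. Qed.

Lemma vir_actJ x t : t \in J -> vir_act x t \in J.
Proof.
move=> tJ; rewrite /vir_act /mext rpred_sum // => -[i|] _; last by rewrite scaler0 rpred0.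
by rewrite rpredZ // (free_act_nrel (@neg_idxD R G) fextU fw_ind).
Qed.

(** Bilinearity of [lie_defect] reduces this to basis vectors, where the central term acts by zero
    and [free_act_lieJ] remains. *)
Lemma vir_act_lieJ x y t : lie_defect vir_act x y t \in J.
Proof.
have vact0 u : vir_act 0 u = 0 := lin0 (vir_act_linearl u).
have vact0r z : vir_act z 0 = 0 := lin0 (vir_act_linear z).
have vactP (a : C) (x1 x2 : vir G) u : vir_act (a *: x1 + x2) u = a *: vir_act x1 u + vir_act x2 u.
  exact: vir_act_linearl.
have vact_c (a : C) : vir_act (a *: vir_c G) t = 0.
  apply: etrans (congr1 (vir_act^~ t) (esym (addr0 _))) _.
  by apply: etrans (vactP _ _ _ _) _; rewrite vir_act_c vact0 scaler0 addr0.
have lie0 z : lie (0 : vir G) z = 0 by have := lieZl 0 (0 : vir G) z; rewrite !scale0r.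
have lie0r z : lie z (0 : vir G) = 0 by have := lieZr 0 z (0 : vir G); rewrite !scale0r.
have Dc z : lie_defect vir_act z (vir_c G) t = 0.
  by rewrite /lie_defect lie_c vact0 !vir_act_c vact0r !subrr.
have Dc' z : lie_defect vir_act (vir_c G) z t = 0.
  rewrite /lie_defect (_ : lie (vir_c G) z = 0); last first.
    by rewrite /lie /= vir_lieC vir_lie_c oppr0.
  by rewrite vact0 !vir_act_c vact0r !subrr.
elim/vir_lin_ind: x => [|a x1 x2 H1 H2|i|].
- by rewrite /lie_defect lie0 !vact0 vact0r !subrr rpred0.
- by rewrite (lie_defectPl vir_act_linear vir_act_linearl) rpredD ?rpredZ.
- elim/vir_lin_ind: y => [|a x1 x2 H1 H2|j|].
  + by rewrite /lie_defect lie0r !vact0 vact0r !subrr rpred0.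
  + by rewrite (lie_defectPr vir_act_linear vir_act_linearl) rpredD ?rpredZ.
  + have := rpredZ (-1) (free_act_lieJ idx (@neg_idxD R G) (@nneg_idxD R G) fextU fw_ind i j t).
rewrite scaleN1r opprB; congr (_ \in J); apply/esym.
    congr (_ - (_ - _)); last 2 first.
    - exact: etrans (vir_act_e i _) (congr1 (fact i) (vir_act_e j t)).
    - exact: etrans (vir_act_e j _) (congr1 (fact j) (vir_act_e i t)).
    apply: etrans (congr1 (vir_act^~ t) (lie_e i j)) _.
    apply: etrans (vactP _ _ _ _) _; rewrite vir_act_e.
    apply: etrans (congr1 (fun u => _ + u) (vact_c _)) _.
    by rewrite addr0.
  + by rewrite Dc rpred0.
- by rewrite Dc' rpred0.
Qed.

Definition vword_lin : T -> M := fext (vword v0).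
HB.instance Definition _ := GRing.Linear.on vword_lin.
Local Notation E := vword_lin.

Definition neg_words : {pred T} := lspan (fun t => exists2 s, all neg s & t = fw s).

(** A single [f] computes both sides: its class in M(0) is the image of [t], and applied to the
    empty word it returns [t] exactly, since negative letters are only put in front. *)
Lemma neg_words_lift t : t \in neg_words -> exists f : free_alg C (vir G),
  E t = quot_proj _ (uea_proj f) /\ free_alg_act vir_act f (fw [::]) = t.
Proof.
rewrite /neg_words; move: t; apply: lspan_ind => [|a t1 t2 [f1 [E1 A1]] [f2 [E2 A2]]|_ [s ns ->]].
- exists 0; rewrite raddf0 (lin0 (free_alg_actP _ _)); split=> //.
  rewrite /uea_proj (raddf0 (\pi_(Quotient.quot (@uea_ideal C (vir G))))%qT).
  by apply/esym; exact: (raddf0 (@quot_proj _ _ _ _)).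
- exists (a *: f1 + f2); rewrite linearP free_alg_actP /= A1 A2 E1 E2; split=> //.
  by rewrite uea_projD -uea_projZ quot_projD quot_projZE.
elim: s ns => [_|i s IH /= /andP[i0 /IH [f [Ef Af]]]].
  exists << mone >>; split; first by rewrite /E fextU.
  by rewrite free_alg_actU /word_act fm1.
exists (free_gen C (vir_e i) * f); split.
  rewrite /E fextU /=; move: Ef; rewrite /E fextU => ->.
  exact: lact_uea_proj.
rewrite free_alg_actM ?Af; first last.
- exact: vir_act_linear.
rewrite /free_gen free_alg_actU /word_act fmU /= vir_act_e.
by rewrite free_act_neg // fconsU.
Qed.

(** The lift [f] of [t] lies in the left ideal defining M(0). The generators of that ideal send the
    empty word into [J], hence so does [f], and the result is [t]. *)
Lemma vword_lin_eq0 t : t \in neg_words -> E t = 0 -> t \in J.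
Proof.
move=> /neg_words_lift [f [-> <-]] /quot_proj_eq0.
have negD := @neg_idxD R G; have nnegD := @nneg_idxD R G.
apply: left_ideal_gen_act.
- exact: vir_act_linear.
- exact: vir_act_linearl.
- exact: vir_actJ.
- exact: vir_act_lieJ.
have genA x : vir_act x (fw [::]) \in J ->
    exists2 f0, uea_gen x = uea_proj f0 & free_alg_act vir_act f0 (fw [::]) \in J.
  by move=> xJ; exists (free_gen C x) => //; rewrite /free_gen free_alg_actU /word_act fmU.
have vact_e i : 0 <= val (i : g) -> vir_act (vir_e i) (fw [::]) = 0.
  by move=> i0; rewrite vir_act_e free_act_nil // /neg_idx -leNgt.
move=> q [[x xn ->]|[|] ->]; apply: genA.
- have vlin := vir_act_linearl (fw [::]).
  elim/lspan_ind: x / xn => [|a u w Hu Hw|_ [i i0 ->]].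
  + by rewrite (lin0 vlin) rpred0.
  + by rewrite vlin rpredD ?rpredZ.
  + by rewrite vact_e ?rpred0 // ltW.
- by rewrite vact_e ?rpred0.
- by rewrite vir_act_c rpred0.
Qed.

Lemma verma0_e_neq0_of_free a : neg a -> lact (vir_e a) v0 != 0.
Proof.
move=> a0; apply/eqP => E0; have := letter_notin_nrel idx neg fextU a.
rewrite vword_lin_eq0 //; last by rewrite /E fextU.
by apply: mem_lspan; exists [:: a]; rewrite //= a0.
Qed.

(** If [v0] were the image of a combination [t] of nonempty words, the empty word minus [t] would
    lie in [J], although its [nil_coef] is 1. *)
Lemma verma0_vec_notin_of_free :
  v0 \notin lspan (fun w => exists s, [/\ s != [::], all neg s & w = vword v0 s]).
Proof.
apply/negP => v0s.
have [t [tn tE t0]] : exists t, [/\ t \in neg_words, E t = v0 & nil_coef fext t = 0].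
  elim/lspan_ind: _ / v0s => [|a u w [t1 [n1 E1 c1]] [t2 [n2 E2 c2]]|_ [s [s0 sn ->]]].
  - by exists 0; rewrite !raddf0 rpred0.
  - exists (a *: t1 + t2); rewrite !linearP /= E1 E2 c1 c2 rpredD ?rpredZ //.
    by rewrite scaler0 addr0.
  - exists (fw s); rewrite /E fextU (nil_coefU fextU) (negPf s0); split=> //.
    by apply: mem_lspan; exists s.
have : fw [::] - t \in J.
  apply: vword_lin_eq0; last by rewrite linearB /= tE /E fextU subrr.
  by rewrite rpredB //; apply: mem_lspan; exists [::].
move/(nil_coef_nrel fextU); rewrite linearB /= t0 (nil_coefU fextU) subr0 => /eqP.
by rewrite oner_eq0.
Qed.

End Verma.

Section VermaNontrivial.
Variables (R : realType) (G : zmodClosed R).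
Local Notation T := ({malg (complex R)[seq (grp G)]}).

Lemma verma0_e_neq0 a : neg_idx a -> lact (vir_e a) (verma0_vec G) != 0.
Proof.
exact: (@verma0_e_neq0_of_free R G T (fun w => << w >>) (fun V f => mext f)
  (fun V f => mextU f) (@malg_ind _ _)).
Qed.

Lemma verma0_vec_notin : verma0_vec G \notin
  lspan (fun w => exists s, [/\ s != [::], all (@neg_idx R G) s & w = vword (verma0_vec G) s]).
Proof.
exact: (@verma0_vec_notin_of_free R G T (fun w => << w >>) (fun V f => mext f)
  (fun V f => mextU f) (@malg_ind _ _)).
Qed.
End VermaNontrivial.

(** * Density of [G] *)

Section Density.
Variables (R : realType) (G : zmodClosed R).
Local Notation g := (grp G).
Implicit Types (i j : g).

Lemma grp_valB i j : val (i - j) = val i - val j. Proof. by []. Qed.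
Lemma grp_valMz i n : val (i *~ n) = val i *~ n.
Proof. exact: (raddfMz (val : g -> R)). Qed.

Hypothesis G_nontrivial : exists2 x : R, x \in G & x != 0.
Hypothesis G_not_Z : forall f : {additive g -> int}, ~ bijective f.

Lemma grp_pos_ex : exists i, 0 < val i.
Proof.
case: G_nontrivial => x xG; rewrite neq_lt => /orP[x0|x0]; last by exists (Grp xG).
by exists (- Grp xG); rewrite grp_valN oppr_gt0.
Qed.

(** Euclidean division by the least positive element [a] leaves no remainder, so the quotient map is
    an isomorphism onto the integers. *)
Lemma grp_min_pos_iso a : 0 < val (a : g) ->
  (forall i, 0 < val i -> val a <= val i) -> exists f : {additive g -> int}, bijective f.
Proof.
move=> a0 amin; pose f i : int := Num.floor (val i / val a).
have fE i : a *~ f i = i.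
  apply/eqP; rewrite eq_sym -subr_eq0; apply/eqP; apply: val_inj.
  rewrite grp_valB grp_valMz grp_val0 -mulrzr.
  have := Num.Theory.floor_itv (val i / val a); rewrite -/(f i) intrD => /andP[l u].
  have lb : 0 <= val i - val a * (f i)%:~R.
    by rewrite subr_ge0 mulrC -ler_pdivlMr.
  have ub : val i - val a * (f i)%:~R < val a.
    by rewrite ltrBlDr mulrC -[X in X + _]mul1r -mulrDl addrC -ltr_pdivrMr.
  apply/eqP; rewrite eq_le lb andbT leNgt; apply/negP => pos.
  have := amin (i - a *~ f i); rewrite grp_valB grp_valMz -mulrzr pos => /(_ isT).
  by rewrite leNgt ub.
have aK : injective (fun n : int => a *~ n).
  move=> m n /(congr1 val); rewrite !grp_valMz => /(mulrIz _); apply.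
  by rewrite gt_eqF.
have fB : zmod_morphism f.
  by move=> i j; apply: aK; rewrite mulrzBr !fE.
pose fM := GRing.isZmodMorphism.Build g int f fB.
pose fA : {additive g -> int} := HB.pack f fM.
exists fA; exists (fun n => a *~ n); first exact: fE.
by move=> n; apply: aK; rewrite fE.
Qed.

(** Otherwise distinct elements of G are at least [e] apart. With [m] minimal such that some
    positive [a] is at most [m e], a smaller positive element would be at most [(m - 1) e]; so [a]
    is the least positive element. *)
Lemma grp_small (e : R) : 0 < e -> exists2 i : g, 0 < val i & val i < e.
Proof.
move=> e0; apply: contrapT => nsmall.
have small i : 0 < val i -> e <= val i.
  by move=> i0; rewrite leNgt; apply/negP => ie; apply: nsmall; exists i.
pose P n := `[< exists2 i : g, 0 < val i & val i <= n%:R * e >].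
have exP : exists n, P n.
  case: grp_pos_ex => i i0; exists (Num.bound (val i / e)); apply/asboolP; exists i => //.
  rewrite -ler_pdivrMr // ltW //; apply: archi_boundP; exact: divr_ge0 (ltW i0) (ltW e0).
case: (ex_minnP exP) => m /asboolP[a a0 am] mmin.
have [i i0|f /G_not_Z //] := grp_min_pos_iso a0.
rewrite leNgt; apply/negP => ia.
have := small (a - i); rewrite grp_valB subr_gt0 => /(_ ia) eai.
have : P m.-1.
  apply/asboolP; exists i => //; case: m am mmin => [|m] am _.
    by move: a0; rewrite ltNge; move: am; rewrite mul0r => ->.
  have {}am : val a <= m%:R * e + e by rewrite -[X in _ + X]mul1r -mulrDl natr1.
  by rewrite -(lerD2r e); apply: le_trans am; rewrite addrC -lerBrDr.
move/mmin; case: m am mmin => [|m] am _; last by rewrite ltnn.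
by move: a0; rewrite ltNge; move: am; rewrite mul0r => ->.
Qed.

Lemma grp_dense (a b : R) : a < b -> exists2 i : g, a < val i & val i < b.
Proof.
rewrite -subr_gt0 => /grp_small[i i0 ib].
(* The first multiple of [i] beyond [a]; it stays below [b] because [i] is shorter than the
   interval. *)
pose n := Num.floor (a / val i); exists (i *~ (n + 1)); rewrite grp_valMz -mulrzr mulrC.
all: have := Num.Theory.floor_itv (a / val i); rewrite -/n => /andP[l u].
  by rewrite -ltr_pdivrMr.
move: l; rewrite intrD ler_pdivlMr // mulrDl mul1r; lra.
Qed.

Lemma grp_dense_seq n (a b : R) : a < b ->
  exists s : seq g, [/\ size s = n, uniq s & forall i, i \in s -> a < val i < b].
Proof.
elim: n a => [|n IH] a ab; first by exists [::].
have [i ai ib] := grp_dense ab; have [s [sn us sP]] := IH _ ib.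
exists (i :: s); split=> /=; [by rewrite sn| |].
  by rewrite us andbT; apply/negP => /sP /andP[]; rewrite ltxx.
move=> j; rewrite inE => /orP[/eqP ->|/sP /andP[ij ->]]; first by rewrite ai.
by rewrite (lt_trans ai).
Qed.

(** Serves to choose an index slightly smaller than [b] subject to finitely many strict lower
    bounds. *)
Lemma grp_dense_above (l : seq R) (b : R) : (forall x, x \in l -> x < b) ->
  exists2 i : g, (forall x, x \in l -> x < val i) & val i < b.
Proof.
move=> lb; pose a := foldr Num.max (b - 1) l.
have [|i ai ib] := @grp_dense a b.
  rewrite {}/a; elim: l lb => [|x l IH] lb /=; first by rewrite ltrBlDr ltrDl.
  rewrite gt_max lb ?mem_head //= IH // => y yl.
  by apply: lb; rewrite inE yl orbT.
exists i => // x xl; apply: le_lt_trans ai; rewrite {}/a.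
elim: l {lb} xl => [//|y l IH]; rewrite inE /= le_max => /orP[/eqP ->|/IH ->].
  by rewrite lexx.
by rewrite orbT.
Qed.
End Density.

(** * Modules generated by a highest weight vector of weight zero *)

Section WittModule.
Variables (R : realType) (G : zmodClosed R) (K : numFieldType).
Local Notation g := (grp G).
Local Notation neg := (@neg_idx R G).
Variables (c : {additive g -> K}) (M : lmodType K) (e : g -> M -> M) (v : M).
Hypothesis c_eq0 : forall i, c i = 0 -> i = 0.
Hypothesis e_linear : forall i, linear (e i).
Hypothesis e_comm : forall i j w, e i (e j w) = e j (e i w) + (c j - c i) *: e (i + j) w.
Hypothesis v_e : forall i, 0 <= val i -> e i v = 0.
Implicit Types (i j k a b m : g) (s : seq g) (w : M) (r n : nat).

Let cD i j : c (i + j) = c i + c j. Proof. exact: raddfD. Qed.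
Let e0 i : e i 0 = 0. Proof. exact: lin0. Qed.
Let eZ i (x : K) w : e i (x *: w) = x *: e i w.
Proof. by rewrite -[x *: w]addr0 e_linear e0 addr0. Qed.
Let eD i w1 w2 : e i (w1 + w2) = e i w1 + e i w2.
Proof. by rewrite -[w1]scale1r e_linear !scale1r. Qed.
Let eB i w1 w2 : e i (w1 - w2) = e i w1 - e i w2.
Proof. by rewrite eD -scaleN1r eZ scaleN1r. Qed.
Let e_sum i (I : Type) (l : seq I) (F : I -> M) :
  e i (\sum_(x <- l) F x) = \sum_(x <- l) e i (F x).
Proof. by elim: l => [|x l IH]; rewrite ?big_nil ?e0 // !big_cons eD IH. Qed.

Let negE i : neg i = (val i < 0). Proof. by []. Qed.
Let vD i j : val (i + j) = val i + val j. Proof. by []. Qed.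

Let submod_closedB (S : submodClosed M) w1 w2 : w1 \in S -> w2 \in S -> w1 - w2 \in S.
Proof. by move=> w1S w2S; rewrite -scaleN1r rpredD ?rpredZ. Qed.

(** * Words in negative letters, filtered by length and graded by weight *)

Definition word s : M := foldr e v s.
Definition wt s : g := \sum_(a <- s) a.

Lemma wt_cons a s : wt (a :: s) = a + wt s. Proof. exact: big_cons. Qed.
Lemma wt_cat s1 s2 : wt (s1 ++ s2) = wt s1 + wt s2. Proof. exact: big_cat. Qed.

Lemma wt_neg s : all neg s -> val (wt s) <= 0.
Proof.
elim: s => [|a s IH] /=; first by rewrite /wt big_nil.
by move=> /andP[a0 /IH s0]; rewrite wt_cons vD; move: a0; rewrite negE; lra.
Qed.

Lemma wt_neg_lt s : all neg s -> s != [::] -> val (wt s) < 0.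
Proof.
case: s => [//|a s] /= /andP[a0 /wt_neg s0] _; rewrite wt_cons vD.
by move: a0; rewrite negE; lra.
Qed.

(** The bound on the length is strict: [word_fil (size s) (wt s)] holds the error terms when [s]
    matters only through its top part, and [word_fil 0 m] is zero. *)
Definition word_fil r m : {pred M} := lspan (fun w => exists s,
  [/\ all neg s, (size s < r)%N, wt s = m & w = word s]).
HB.instance Definition _ r m := GRing.SubmodClosed.on (word_fil r m).

Lemma word_fil_ind r m (P : M -> Prop) : P 0 ->
  (forall x u w, P u -> P w -> P (x *: u + w)) ->
  (forall s, all neg s -> (size s < r)%N -> wt s = m -> P (word s)) ->
  forall w, w \in word_fil r m -> P w.
Proof. by move=> P0 PD Ps; apply: lspan_ind => // _ [s [? ? ? ->]]; apply: Ps. Qed.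

Lemma word_fil_op (f : M -> M) r m (S : submodClosed M) : linear f ->
  (forall s, all neg s -> (size s < r)%N -> wt s = m -> f (word s) \in S) ->
  forall w, w \in word_fil r m -> f w \in S.
Proof. by move=> fl fS; apply: lspan_op => // _ [s [? ? ? ->]]; apply: fS. Qed.

Lemma mem_word_fil s r m : all neg s -> (size s < r)%N -> wt s = m ->
  word s \in word_fil r m.
Proof. by move=> ns sr ws; apply: mem_lspan; exists s. Qed.

Lemma word_fil_le r r' m w : (r <= r')%N -> w \in word_fil r m -> w \in word_fil r' m.
Proof.
move=> rr'; apply: (@word_fil_op id) => // s ns sr ws.
by apply: mem_word_fil => //; apply: leq_trans rr'.
Qed.

Lemma word_fil_cast r m m' w : m = m' -> w \in word_fil r m -> w \in word_fil r m'.
Proof. by move=> ->. Qed.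

Lemma word_fil_neg a r m w : neg a -> w \in word_fil r m -> e a w \in word_fil r.+1 (a + m).
Proof.
move=> a0; apply: word_fil_op => [|s ns sr ws]; first exact: e_linear.
by apply: (@mem_word_fil (a :: s)); rewrite /= ?a0 // wt_cons ws.
Qed.

(** On its way to [v], which kills it, [e_i] survives only by merging with a letter, so no word gets
    longer. *)
Lemma word_nneg i s : 0 <= val i -> all neg s -> e i (word s) \in word_fil (size s).+1 (i + wt s).
Proof.
elim: s i => [|a s IH] i i0 /=; first by rewrite v_e ?rpred0.
move=> /andP[a0 ns]; rewrite e_comm wt_cons rpredD //.
  by rewrite addrCA word_fil_neg ?IH.
rewrite rpredZ // addrA; have [ia|ia] := boolP (neg (i + a)).
  by apply: (@mem_word_fil (i + a :: s)); rewrite /= ?ia // wt_cons.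
by apply: (@word_fil_le (size s).+1) => //; rewrite IH // leNgt.
Qed.

Lemma word_fil_nneg i r m w : 0 <= val i -> w \in word_fil r m -> e i w \in word_fil r (i + m).
Proof.
move=> i0; apply: word_fil_op => [|s ns sr ws]; first exact: e_linear.
by apply: word_fil_le sr _; rewrite -ws word_nneg.
Qed.

Lemma word_fil_pos r m w : 0 < val m -> w \in word_fil r m -> w = 0.
Proof.
move=> m0; elim/word_fil_ind => // [a u u' -> ->|s ns _ ws].
  by rewrite scaler0 addr0.
by move: m0; rewrite -ws ltNge wt_neg.
Qed.

Lemma word_insert a s1 s2 : neg a -> all neg s1 -> all neg s2 ->
  word (a :: s1 ++ s2) - word (s1 ++ a :: s2)
    \in word_fil (size (s1 ++ s2)).+1 (wt (a :: s1 ++ s2)).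
Proof.
move=> a0 + n2; elim: s1 => [_|b s1 IH /= /andP[b0 n1]]; first by rewrite subrr rpred0.
set X := foldr e v (s1 ++ s2); set Y := foldr e v (s1 ++ a :: s2).
rewrite e_comm addrAC -eB rpredD //.
  apply: word_fil_cast (word_fil_neg b0 (IH n1)).
  by rewrite !wt_cons addrCA.
rewrite rpredZ //; apply: (@mem_word_fil (a + b :: s1 ++ s2)) => //=.
  by rewrite neg_idxD // all_cat n1 n2.
by rewrite !wt_cons addrA.
Qed.

(** Every commutator merges two negative letters into a single negative one of the same total
    weight. *)
Lemma word_perm s1 s2 : perm_eq s1 s2 -> all neg s1 ->
  word s1 - word s2 \in word_fil (size s1) (wt s1).
Proof.
elim: s1 s2 => [|a s1 IH] s2.
  by move=> /perm_size/esym/size0nil -> _; rewrite subrr rpred0.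
move=> p12 /= /andP[a0 n1]; have := perm_mem p12 a; rewrite mem_head => /esym as2.
case/splitPr: as2 p12 => s3 s4 p12.
have p : perm_eq s1 (s3 ++ s4).
  by move: p12; rewrite -[a :: s4]cat1s perm_sym perm_catCA /= perm_cons perm_sym.
have n34 : all neg (s3 ++ s4) by rewrite -(perm_all _ p).
have /andP[n3 n4] : all neg s3 && all neg s4 by rewrite -all_cat.
have -> : e a (word s1) - word (s3 ++ a :: s4) =
    e a (word s1 - word (s3 ++ s4)) + (word (a :: s3 ++ s4) - word (s3 ++ a :: s4)).
  by rewrite eB addrA subrK.
rewrite rpredD //; first by rewrite wt_cons word_fil_neg ?IH.
rewrite (perm_size p) (_ : wt (a :: s1) = wt (a :: s3 ++ s4)) ?word_insert //.
by rewrite !wt_cons /wt (perm_big _ p).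
Qed.

(* [e_j] with [j] slightly smaller than [- A], seen on top length: only the
   letters [A] survive. *)
Lemma word_lower A j s : 0 < val j -> neg A -> neg (A + j) -> all neg s ->
  (forall a, a \in s -> a = A \/ 0 <= val (a + j)) ->
  e j (word s) - ((c A - c j) * (count_mem A s)%:R) *: word (A + j :: rem A s)
    \in word_fil (size s) (j + wt s).
Proof.
move=> j0 A0 Aj0; elim: s => [|a s IH] /=.
  by move=> _ _; rewrite v_e ?ltW // mulr0 scale0r subr0 rpred0.
move=> /andP[a0 ns] sA; have {}IH := IH ns (fun b bs => sA b (mem_behead (s := a :: s) bs)).
set n := (count_mem A s)%:R in IH *.
have eIH := word_fil_neg a0 IH; rewrite addrCA -wt_cons in eIH.
rewrite e_comm; set W := word s in IH eIH *; set X := word (A + j :: rem A s) in IH eIH *.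
have fA : A \in s -> [/\ all neg (rem A s), size s = (size (rem A s)).+1 &
    wt s = A + wt (rem A s)].
  move=> As; have pA := perm_to_rem As; split.
  - by move: ns; rewrite (perm_all _ pA) => /andP[].
  - by rewrite (perm_size pA).
  - by rewrite /wt (perm_big _ pA) big_cons.
have swap s' : A \in s -> perm_eq s' (a :: rem A s) ->
    e a X - word (A + j :: s') \in word_fil (size s).+1 (j + wt (a :: s)).
  move=> As p; have [nA sz ws] := fA As.
  have -> : (size s).+1 = size (a :: A + j :: rem A s) by rewrite /= sz.
  have -> : j + wt (a :: s) = wt (a :: A + j :: rem A s).
    by rewrite !wt_cons ws addrCA -addrA [j + (A + _)]addrCA.
  apply: word_perm => /=; last by rewrite a0 Aj0.
  rewrite -[a :: _]cat1s -[A + j :: _]cat1s perm_catCA /= perm_cons.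
  by rewrite perm_sym.
rewrite eB eZ in eIH.
have [aA|aA] := eqVneq a A.
  rewrite aA in swap eIH *; rewrite [j + A]addrC natrD.
  set Y := word (A + j :: s) in swap *.
  have -> : e (A + j) W = Y by [].
  have [As|As] := boolP (A \in s).
    have sw := rpredZ ((c A - c j) * n) (swap s As (perm_to_rem As)).
    apply: (mem_congr (rpredD eIH sw)).
    by lmod_coefs K M; rewrite /n /=; ring.
  have n0 : n = 0 by rewrite /n (count_memPn As).
  apply: (mem_congr eIH); rewrite -/n n0.
  by lmod_coefs K M; rewrite /=; ring.
(* For [a] different from [A] the merged letter [j + a] is nonnegative, so it does not lengthen the
   remaining word and goes into the error. *)
rewrite add0n; have ja : e (j + a) W \in word_fil (size s).+1 (j + wt (a :: s)).
  rewrite wt_cons addrA word_nneg //.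
  by case: (sA a (mem_head _ _)) => [/eqP|]; [rewrite (negPf aA)|rewrite addrC].
have {}ja := rpredZ (c a - c j) ja.
have [As|As] := boolP (A \in s).
  have sw := rpredZ ((c A - c j) * n) (swap (a :: rem A s) As (perm_refl _)).
  apply: (mem_congr (rpredD (rpredD eIH sw) ja)).
  by lmod_coefs K M; rewrite -/n /=; ring.
have n0 : n = 0 by rewrite /n (count_memPn As).
apply: (mem_congr (rpredD eIH ja)); rewrite -/n n0.
by lmod_coefs K M; rewrite /=; ring.
Qed.

(* The condition on [k] says that [e_k] stays a raising operator after absorbing
   any proper part of the word. *)
Lemma word_absorb s : all neg s -> exists2 Q : {poly K}, size Q = (size s).+1 &
  forall k, (forall a, a \in s -> 0 < val (k + wt s - a)) ->
    e k (word s) = Q.[c k] *: e (k + wt s) v.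
Proof.
elim: s => [_|a s IH /= /andP[a0 ns]].
  exists 1; first by rewrite size_poly1.
  by move=> k _; rewrite hornerE scale1r /wt big_nil addr0.
(* Commuting [e_k] past [e_a] gives the factor [c a - c k] and replaces [k] by [k + a], hence the
   shifted argument. *)
have [Q sQ QP] := IH ns; exists (((c a)%:P - 'X) * (Q \Po ('X + (c a)%:P))).
  have sX : size ((c a)%:P - 'X : {poly K}) = 2%N by rewrite -opprB size_polyN size_XsubC.
  have sQ' : size (Q \Po ('X + (c a)%:P)) = size Q by rewrite size_comp_poly2 // size_XaddC.
  have Q0 : Q \Po ('X + (c a)%:P) != 0 by rewrite -size_poly_eq0 sQ' sQ.
  by rewrite size_mul -?size_poly_eq0 ?sX ?sQ' ?sQ.
move=> k kP; have ka : 0 < val (k + wt s).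
  have := kP a (mem_head _ _).
  by rewrite wt_cons [a + _]addrC addrA addrK.
have k0 : 0 <= val k.
  by have := wt_neg ns; move: ka; rewrite vD; lra.
(* The term in which [e_k] passes [a] unmerged vanishes, since [k + wt s] is positive. *)
rewrite e_comm (word_fil_pos ka (word_nneg k0 ns)) e0 add0r.
rewrite QP => [|b bs].
  rewrite scalerA wt_cons addrA !hornerE horner_comp !hornerE cD.
  by congr (_ *: _).
have := kP b (mem_behead (s := a :: s) bs).
by rewrite wt_cons addrA.
Qed.

(** Words shorter than [r] yield polynomials of degree below [r], too small to cancel the
    contribution of a word of length [r]. The second component of [Q] lists lower thresholds for
    [k]. *)
Lemma word_fil_absorb r m w : w \in word_fil r m -> exists Q : {poly K} * seq R,
  [/\ (size Q.1 <= r)%N, forall x, x \in Q.2 -> x < - val m &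
   forall k, (forall x, x \in Q.2 -> x < val k) -> e k w = Q.1.[c k] *: e (k + m) v].
Proof.
elim/word_fil_ind => [|x u1 u2 [[Q1 l1] [/= s1 b1 P1]] [[Q2 l2] [/= s2 b2 P2]]|s ns sr ws].
- by exists (0, [::]); split=> //= [|k _]; rewrite ?size_poly0 // e0 horner0 scale0r.
- exists (x *: Q1 + Q2, l1 ++ l2); split=> /=.
  + rewrite (leq_trans (size_polyD _ _)) // geq_max s2 andbT.
    exact: leq_trans (size_scale_leq _ _) s1.
  + by move=> y; rewrite mem_cat => /orP[/b1|/b2].
  + move=> k kl; rewrite e_linear P1 ?P2 => [|y yl|y yl]; rewrite ?kl ?mem_cat ?yl ?orbT //.
    by rewrite hornerD hornerZ scalerDl scalerA.
have [Q sQ QP] := word_absorb ns; exists (Q, [seq val a - val m | a <- s]); split=> /=.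
- by rewrite sQ.
- by move=> _ /mapP[a /(allP ns) a0 ->]; rewrite ltrBlDr addNr.
- move=> k kl; rewrite QP ?ws // => a as_.
  by rewrite grp_valB subr_gt0 vD -ltrBlDr kl ?(map_f (fun b => val b - val m)).
Qed.

(** * Extraction of some e_i v from a homogeneous element *)

Hypothesis G_nontrivial : exists2 x : R, x \in G & x != 0.
Hypothesis G_not_Z : forall f : {additive g -> int}, ~ bijective f.

Lemma c_inj : injective c.
Proof.
move=> i j /eqP; rewrite -subr_eq0 -raddfB => /eqP/c_eq0/eqP.
by rewrite subr_eq0 => /eqP.
Qed.

(** On [w], [e_k] acts as a polynomial in [c k] of degree exactly [size s], and density offers one
    more value of [k] than it can have roots. *)
Lemma absorb_monomial (S : submodClosed M) (x : K) s w :
  (forall i u, 0 <= val i -> u \in S -> e i u \in S) -> x != 0 -> all neg s -> s != [::] ->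
  w \in S -> w - x *: word s \in word_fil (size s) (wt s) ->
  exists2 i, neg i & e i v \in S.
Proof.
move=> Se x0 ns s0 wS /word_fil_absorb[[Q l] [/= sQ lP QP]].
have [Q' sQ' QP'] := word_absorb ns.
pose P := Q + x *: Q'; have sP : size P = (size s).+1.
  by rewrite /P addrC size_polyDl size_scale // ?sQ' ?ltnS.
have P0 : P != 0 by rewrite -size_poly_eq0 sP.
have wt0 : val (wt s) < 0 by exact: wt_neg_lt.
(* The entry 0 makes [k] positive, [l] serves the shorter words, and the last list serves [s]
   itself. *)
have [|b bl bs] := @grp_dense_above R G G_nontrivial G_not_Z
    (0 :: l ++ [seq val a - val (wt s) | a <- s]) (- val (wt s)).
  move=> y; rewrite inE mem_cat => /or3P[/eqP ->|/lP //|/mapP[a as_ ->]].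
    by rewrite oppr_gt0.
  by have := allP ns _ as_; rewrite negE; lra.
have [ks [sks uks ksP]] := @grp_dense_seq R G G_nontrivial G_not_Z (size s).+1 _ _ bs.
have [k kks Pk] : exists2 k, k \in ks & P.[c k] != 0.
  apply: contrapT => noroot.
  have : all (root P) (map c ks).
    apply/allP => _ /mapP[k kks ->]; apply: contrapT => /negP Pk.
    by apply: noroot; exists k => //; move: Pk; rewrite rootE.
  move/(max_poly_roots P0); rewrite map_inj_uniq ?uks; last exact: c_inj.
  by rewrite size_map sks sP ltnn => /(_ isT).
have /andP[bk ks0] := ksP _ kks.
have kl y : y \in 0 :: l ++ [seq val a - val (wt s) | a <- s] -> y < val k.
  by move=> /bl yb; apply: lt_trans bk.
exists (k + wt s); first by rewrite negE vD addrC -ltrBrDl sub0r.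
have k0 : 0 <= val k by rewrite ltW // kl ?mem_head.
have kll y : y \in l -> y < val k by move=> yl; rewrite kl // inE mem_cat yl orbT.
have E1 := QP k kll; rewrite eB eZ QP' in E1; last first.
  move=> a as_; rewrite grp_valB subr_gt0 vD -ltrBlDr kl // inE mem_cat.
  by rewrite (map_f (fun b => val b - val (wt s))) ?orbT.
have E2 : e k w = P.[c k] *: e (k + wt s) v.
  rewrite -[LHS](subrK (x *: (Q'.[c k] *: e (k + wt s) v))) E1.
  by rewrite scalerA -scalerDl /P !hornerE.
have := Se k w k0 wS; rewrite E2 => kS.
have -> : e (k + wt s) v = P.[c k]^-1 *: (P.[c k] *: e (k + wt s) v).
  by rewrite scalerA mulVf // scale1r.
by rewrite rpredZ.
Qed.

Definition grp_leq : rel g := fun a b => val a <= val b.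

Lemma grp_leq_total : total grp_leq.
Proof. by move=> a b; apply: le_total. Qed.
Lemma grp_leq_trans : transitive grp_leq.
Proof. by move=> a b d; apply: le_trans. Qed.

Lemma grp_seq_min (l : seq g) : l != [::] ->
  exists2 a, a \in l & forall b, b \in l -> val a <= val b.
Proof.
elim: l => [//|a [|b l] IH] _.
  by exists a; rewrite ?mem_head // => b; rewrite inE => /eqP ->.
have [d dl dmin] := IH isT; have [ad|da] := leP (val a) (val d).
  exists a; rewrite ?mem_head // => x; rewrite in_cons => /orP[/eqP -> //|/dmin].
  exact: le_trans.
exists d => [|x]; first by rewrite in_cons dl orbT.
by rewrite in_cons => /orP[/eqP ->|/dmin //]; apply: ltW.
Qed.

Lemma sorted_min_behead A s : sorted grp_leq s -> A \in s ->
  (forall b, b \in s -> val A <= val b) -> s = A :: behead s.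
Proof.
case: s => [//|a s] /= ps; rewrite inE => /orP[/eqP -> //|As] Amin; congr (_ :: _).
apply: val_inj; apply/eqP; rewrite eq_le Amin ?mem_head // andbT.
exact: (allP (order_path_min grp_leq_trans ps)).
Qed.

(** In [s ++ d], [s] holds the letters still to be treated and [d] those already raised; the new
    letter [A + j] joins the front of [d]. *)
Lemma word_lower_step A j s d : 0 < val j -> neg A -> neg (A + j) -> all neg s ->
  all neg d -> sorted grp_leq s -> A \notin d ->
  (forall b, b \in s -> val A <= val b) ->
  (forall b, b \in s ++ d -> b != A -> 0 <= val (b + j)) ->
  e j (word (s ++ d)) -
    (if A \in s then ((c A - c j) * (count_mem A s)%:R) *: word (behead s ++ A + j :: d)
     else 0) \in word_fil (size (s ++ d)) (j + wt (s ++ d)).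
Proof.
move=> j0 A0 Aj0 ns nd ss Ad Amin bj.
have nsd : all neg (s ++ d) by rewrite all_cat ns.
have bjA b : b \in s ++ d -> b = A \/ 0 <= val (b + j).
  by move=> bs; have [->|bA] := eqVneq b A; [left|right; apply: bj].
have := word_lower j0 A0 Aj0 nsd bjA; rewrite count_cat (count_memPn Ad) addn0 => H.
have [As|As] := boolP (A \in s); last first.
  by apply: (mem_congr H); rewrite (count_memPn As) mulr0 scale0r.
have sE := sorted_min_behead ss As Amin.
have nb : all neg (behead s) by move: ns; rewrite sE => /andP[].
have remE : rem A (s ++ d) = behead s ++ d by rewrite sE /= eqxx.
rewrite remE in H.
have ins := word_insert Aj0 nb nd.
have szE : size (s ++ d) = (size (behead s ++ d)).+1 by rewrite [in LHS]sE.
have wtE : j + wt (s ++ d) = wt (A + j :: behead s ++ d).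
  by rewrite [in LHS]sE /= !wt_cons addrA [j + A]addrC.
rewrite -szE -wtE in ins.
apply: (mem_congr (rpredD H (rpredZ ((c A - c j) * (count_mem A s)%:R) ins))).
by lmod_coefs K M; rewrite /=; ring.
Qed.

(** Induction on the number [n] of untreated letters. Raising the lowest letter [A] of all the words
    in [L] discards the words without [A] and takes one [A] from the others. These stay distinct,
    being sorted and hence starting with [A], and they share the tail [d]. *)
Lemma lower_to_monomial (S : submodClosed M) n :
  (forall i u, 0 <= val i -> u \in S -> e i u \in S) ->
  forall (L : seq (seq g)) (x : seq g -> K) d w m,
  L != [::] -> uniq L ->
  (forall s, s \in L -> [/\ x s != 0, sorted grp_leq s, all neg s, size s = n & wt (s ++ d) = m]) ->
  (forall s a b, s \in L -> a \in s -> b \in d -> val a < val b) ->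
  all neg d -> w \in S ->
  w - \sum_(s <- L) x s *: word (s ++ d) \in word_fil (n + size d) m ->
  exists d' y w', [/\ y != 0, all neg d', size d' = (n + size d)%N, w' \in S &
    w' - y *: word d' \in word_fil (size d') (wt d')].
Proof.
move=> Se; elim: n => [|n IH] L x d w m L0 uL LP Ld nd wS wL.
  (* With no untreated letters left, a duplicate-free [L] holds the empty word only. *)
  have LE : L = [:: [::]].
    have nilP s : s \in L -> s = [::] by move=> /LP[_ _ _ /size0nil].
    case: L L0 uL nilP {LP Ld wL} => [//|s [|s' L]] _ uL nilP.
      by rewrite (nilP s) ?mem_head.
    move: uL; rewrite (nilP s) ?mem_head // (nilP s') ?inE ?eqxx ?orbT //.
  have [|x0 _ _ _ wd] := LP [::]; first by rewrite LE mem_head.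
  exists d, (x [::]), w; split=> //.
  by move: wL; rewrite LE big_seq1 /= -wd.
pose F := flatten L.
have memF s a : s \in L -> a \in s -> a \in F.
  by move=> sL as_; apply/flattenP; exists s.
have nF a : a \in F -> neg a by move=> /flattenP[s /LP[_ _ ns _ _] /(allP ns)].
have F0 : F != [::].
  case: L L0 LP {uL Ld wL} @F memF nF => [//|s L] _ LP F memF nF.
  have [|_ _ _ ss _] := LP s; first exact: mem_head.
  case: s ss LP @F memF nF => [//|a s] _ LP F memF nF.
  by apply/eqP => F0; have := memF (a :: s) a; rewrite F0 !mem_head => /(_ isT isT).
have [A AF Amin] := grp_seq_min F0; have A0 := nF _ AF.
have Ad : A \notin d.
  apply/negP => Ad; case/flattenP: AF => s sL As.
  by have := Ld _ _ _ sL As Ad; rewrite ltxx.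
(* The bounds make [j] positive, turn every letter other than [A] nonnegative when [j] is added, and
   put [A + j] above all untreated letters; [j] below [- A] keeps [A + j] negative. *)
have [|j jl jA] := @grp_dense_above R G G_nontrivial G_not_Z
    (0 :: [seq - val b | b <- F ++ d & b != A] ++ [seq val b - val A | b <- F]) (- val A).
  move=> y; rewrite inE mem_cat => /or3P[/eqP ->|/mapP[b]|/mapP[b bF ->]].
  - by rewrite oppr_gt0.
  - rewrite mem_filter mem_cat => /andP[bA bFd] ->; rewrite ltrN2.
    case/orP: bFd => [bF|bd]; last by have /flattenP[s sL As] := AF; exact: Ld sL As bd.
    rewrite lt_neqAle Amin // andbT; apply: contraNneq bA => /val_inj ->.
    by rewrite eqxx.
  - by rewrite ltrBlDr addNr; exact: nF.
have j0 : 0 < val j by apply: jl; rewrite mem_head.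
have Aj0 : neg (A + j) by rewrite negE vD addrC -ltrBrDr sub0r.
have bj b : b \in F ++ d -> b != A -> 0 <= val (b + j).
  move=> bFd bA; rewrite vD addrC -lerBlDr sub0r ltW // jl // inE mem_cat.
  by rewrite (map_f (fun b : g => - val b)) ?orbT // mem_filter bA.
have FAj a : a \in F -> val a < val (A + j).
  move=> aF; rewrite vD addrC -ltrBlDr jl // inE mem_cat.
  by rewrite (map_f (fun b : g => val b - val A)) ?orbT.
have sE s : s \in L -> A \in s -> s = A :: behead s.
  move=> sL As; have [_ ss _ _ _] := LP _ sL.
  by apply: sorted_min_behead => // b /(memF _ _ sL)/Amin.
(* Nonzero when [A] occurs in [s]: [A] is negative and [j] positive, and a positive multiplicity is
   nonzero in characteristic zero. *)
pose k s := (c A - c j) * (count_mem A s)%:R.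
pose L' := [seq behead s | s <- L & A \in s].
pose x' u := x (A :: u) * k (A :: u).
have L'P u : u \in L' -> A :: u \in L.
  by move=> /mapP[s]; rewrite mem_filter => /andP[As sL] ->; rewrite -sE.
have sumE : \sum_(s <- L) x s *: (if A \in s then k s *: word (behead s ++ A + j :: d) else 0)
    = \sum_(u <- L') x' u *: word (u ++ A + j :: d).
  rewrite big_map big_filter [RHS]big_mkcond /= !big_seq; apply: eq_bigr => s sL.
  case: ifP => As; last by rewrite scaler0.
  by rewrite scalerA /x' -(sE s sL As).
rewrite addSnnS; apply: (IH L' x' (A + j :: d) (e j w) (j + m)).
- case/flattenP: AF => s sL As; apply/eqP => L'0.
  have : behead s \in L' by apply: map_f; rewrite mem_filter As.
  by rewrite L'0.
- rewrite map_inj_in_uniq ?filter_uniq // => s1 s2.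
  rewrite !mem_filter => /andP[As1 s1L] /andP[As2 s2L] E.
  by rewrite (sE s1) // (sE s2) // E.
- move=> u /L'P AuL; have [x0 su /andP[_ nu] [zu] wu] := LP _ AuL; split=> //.
  + rewrite mulf_neq0 // mulf_neq0 ?pnatr_eq0 /= ?eqxx // subr_eq0.
    by apply/eqP => /c_inj Aj; move: A0; rewrite negE Aj ltNge ltW.
  + exact: path_sorted su.
  + rewrite -wu !wt_cat !wt_cons !addrA; congr (_ + _).
    by rewrite addrC [wt u + A]addrC addrA.
- move=> u a b /L'P AuL au; rewrite inE => /orP[/eqP ->|bd].
    by apply: FAj; apply: memF AuL _; rewrite inE au orbT.
  by apply: Ld AuL _ bd; rewrite inE au orbT.
- by rewrite /= Aj0.
- by rewrite Se // ltW.
rewrite /= -addSnnS; have H1 := word_fil_nneg (ltW j0) wL.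
have H2 : \sum_(s <- L) x s *: (e j (word (s ++ d)) -
    (if A \in s then k s *: word (behead s ++ A + j :: d) else 0))
    \in word_fil (n.+1 + size d) (j + m).
  rewrite big_seq rpred_sum // => s sL; rewrite rpredZ //.
  have [_ ss ns zs <-] := LP _ sL; rewrite -zs -size_cat.
  apply: word_lower_step => // b; first by move=> /(memF _ _ sL)/Amin.
  by rewrite mem_cat => /orP[/(memF _ _ sL) bF|bd]; apply: bj; rewrite mem_cat ?bF ?bd ?orbT.
apply: (mem_congr (rpredD H1 H2)); rewrite eB e_sum -sumE.
have -> : \sum_(s <- L) e j (x s *: word (s ++ d)) = \sum_(s <- L) x s *: e j (word (s ++ d)).
  by apply: eq_bigr => s _; rewrite eZ.
under [X in _ = _ + X]eq_bigr do rewrite scalerBr.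
by rewrite sumrB addrA subrK.
Qed.

(** Sorting the letters of a word costs only shorter words, so sorted words of full length carry the
    top part. *)
Lemma word_fil_top r m w : w \in word_fil r.+1 m -> exists t : {malg K[seq g]},
  (forall s, s \in msupp t -> [/\ sorted grp_leq s, all neg s, size s = r & wt s = m]) /\
  w - mext word t \in word_fil r m.
Proof.
elim/word_fil_ind => [|x u1 u2 [t1 [T1 E1]] [t2 [T2 E2]]|s ns sr ws].
- by exists 0; rewrite msupp0 raddf0 subr0 rpred0; split.
- exists (x *: t1 + t2); split=> [s|].
    move=> /(fsubsetP (msuppD_le _ _)); rewrite in_fsetU => /orP[|/T2 //].
    by move=> /(fsubsetP (msuppZ_le _ _))/T1.
  apply: (mem_congr (rpredD (rpredZ x E1) E2)); rewrite linearP /=.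
  by lmod_coefs K M; rewrite /=; ring.
have [sz|sz] := eqVneq (size s) r; last first.
  exists 0; rewrite msupp0 raddf0 subr0; split=> //.
  by apply: mem_word_fil => //; rewrite ltn_neqAle sz.
exists << sort grp_leq s >>; rewrite mextU; split=> [s'|].
  move=> /(fsubsetP msuppU_le); rewrite in_fset1 => /eqP ->; split.
  - exact: sort_sorted grp_leq_total _.
  - by rewrite all_sort.
  - by rewrite size_sort.
  - by rewrite /wt (perm_big s) // perm_sort.
by rewrite -sz -ws; apply: word_perm => //; rewrite perm_sym perm_sort.
Qed.

(** The induction descends to the least filtration step containing [w]. There the representative [t]
    of the top part is nonzero by minimality: were it zero, [w] would lie one step lower. *)
Lemma raise_homogeneous (S : submodClosed M) r m w :
  (forall i u, 0 <= val i -> u \in S -> e i u \in S) ->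
  val m < 0 -> w \in S -> w != 0 -> w \in word_fil r m -> exists2 i, neg i & e i v \in S.
Proof.
move=> Se m0 wS w0; elim: r => [|r IH].
  move=> wF; case/eqP: w0; elim/word_fil_ind: wF => // x u1 u2 -> ->.
  by rewrite scaler0 addr0.
move=> wF1; have [/IH //|wF] := pselect (w \in word_fil r m).
have [t [tP wt_]] := word_fil_top wF1.
have t0 : msupp t != fset0.
  apply/eqP => t0; apply: wF.
  by move: wt_; rewrite /mext t0 big_seq_fset0 subr0.
(* The empty word has weight zero, whereas [m] is negative. *)
have r0 : (0 < r)%N.
  have /fset0Pn[s /tP[_ _ <- ws]] := t0; case: s ws => //.
  by move=> m0'; move: m0; rewrite -m0' /wt big_nil ltxx.
have [|||||||d [y [w' [y0 nd sd w'S w'd]]]] :=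
    @lower_to_monomial S r Se (msupp t) (fun s => t@_s) [::] w m.
- have /fset0Pn[s st] := t0; apply/eqP => E.
  by have : s \in enum_fset (msupp t) by []; rewrite E.
- exact: fset_uniq.
- by move=> s st; have [? ? ? ?] := tP _ st; split=> //; rewrite ?mcoeff_neq0 ?cats0.
- by [].
- by [].
- exact: wS.
- by rewrite addn0; under eq_bigr do rewrite cats0; exact: wt_.
apply: absorb_monomial w'd => //.
by rewrite -size_eq0 sd addn0 -lt0n.
Qed.

(** * Weight decomposition and the span of the nonempty words *)

Definition neg_span : {pred M} := lspan (fun w => exists2 s, all neg s & w = word s).
HB.instance Definition _ := GRing.SubmodClosed.on neg_span.

(** The augmentation ideal of U(n_-) applied to [v]. *)
Definition aug_span : {pred M} :=
  lspan (fun w => exists s, [/\ s != [::], all neg s & w = word s]).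
HB.instance Definition _ := GRing.SubmodClosed.on aug_span.

Lemma neg_span_e i w : w \in neg_span -> e i w \in neg_span.
Proof.
apply: lspan_op => [|_ [s ns ->]]; first exact: e_linear.
have [i0|i0] := boolP (neg i).
  by apply: mem_lspan; exists (i :: s); rewrite /= ?i0.
rewrite -leNgt in i0; move: (word_nneg i0 ns); apply: (@word_fil_op id) => // s' ns' _ _.
by apply: mem_lspan; exists s'.
Qed.

Lemma neg_span_aug w : w \in neg_span -> exists x, w - x *: v \in aug_span.
Proof.
move: w; apply: lspan_ind => [|x u1 u2 [x1 H1] [x2 H2]|_ [[|a s] ns ->]].
- by exists 0; rewrite scale0r subr0 rpred0.
- exists (x * x1 + x2); apply: (mem_congr (rpredD (rpredZ x H1) H2)).
  by lmod_coefs K M; rewrite /=; ring.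
- by exists 1; rewrite scale1r subrr rpred0.
- by exists 0; rewrite scale0r subr0; apply: mem_lspan; exists (a :: s).
Qed.

Lemma aug_span_e i w : w \in neg_span -> e i w \in aug_span.
Proof.
have aS a u : neg a -> u \in neg_span -> e a u \in aug_span.
  move=> a0; move: u; apply: lspan_op => [|_ [s ns ->]]; first exact: e_linear.
  by apply: mem_lspan; exists (a :: s); rewrite /= a0.
move: w; apply: lspan_op => [|_ [s ns ->]]; first exact: e_linear.
have sS s' : all neg s' -> word s' \in neg_span by move=> ?; apply: mem_lspan; exists s'.
elim: s ns i => [_|a s IH /= /andP[a0 ns]] i; (have [i0|i0] := boolP (neg i);
  first by apply: aS => //; apply: (sS [::]) || apply: (sS (a :: s)); rewrite /= ?a0).
  by rewrite v_e ?rpred0 // leNgt.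
by rewrite e_comm rpredD ?rpredZ ?IH // aS // neg_span_e // sS.
Qed.

Lemma lspan_words (X : M -> Prop) (P : seq g -> Prop) w :
  (forall u, X u -> exists2 s, P s & u = word s) -> w \in lspan X ->
  exists2 L : seq (K * seq g), (forall p, p \in L -> P p.2) &
    w = \sum_(p <- L) p.1 *: word p.2.
Proof.
move=> XP; elim/lspan_ind: _ / => [|x u1 u2 [L1 P1 ->] [L2 P2 ->]|u /XP[s Ps ->]].
- by exists [::]; rewrite ?big_nil.
- exists ([seq (x * p.1, p.2) | p <- L1] ++ L2) => [p|].
    by rewrite mem_cat => /orP[/mapP[q /P1 Pq -> //]|/P2].
  rewrite big_cat big_map scaler_sumr; congr (_ + _).
  by apply: eq_bigr => p _; rewrite scalerA.
- exists [:: (1, s)] => [p|]; first by rewrite inE => /eqP ->.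
  by rewrite big_seq1 scale1r.
Qed.

Lemma e_zero_word s : e 0 (word s) = c (wt s) *: word s.
Proof.
elim: s => [|a s IH] /=; first by rewrite v_e // /wt big_nil raddf0 scale0r.
rewrite e_comm IH eZ wt_cons raddf0 subr0 add0r cD.
by lmod_coefs K M; rewrite /=; ring.
Qed.

(** The operator [e 0 - c n] removes the component of weight [n] and multiplies the others by
    nonzero scalars, as weights are distinct eigenvalues. *)
Lemma eigen_parts (S : submodClosed M) (W : seq g) (f : g -> M) :
  (forall u, u \in S -> e 0 u \in S) -> uniq W ->
  (forall m, m \in W -> e 0 (f m) = c m *: f m) ->
  \sum_(m <- W) f m \in S -> forall m, m \in W -> f m \in S.
Proof.
move=> S0; elim: W f => [//|n W IH] f /= /andP[nW uW] fE fS.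
have fS' : \sum_(m <- W) (c m - c n) *: f m \in S.
  apply: (mem_congr (submod_closedB (S0 _ fS) (rpredZ (c n) fS))).
  rewrite e_sum !big_cons scalerDr fE ?mem_head // opprD addrACA subrr add0r.
  rewrite scaler_sumr -sumrB; apply: eq_big_seq => m mW.
  by rewrite fE ?in_cons ?mW ?orbT // scalerBl.
have fW m : m \in W -> f m \in S.
  move=> mW; have mn : c m - c n != 0.
    by rewrite subr_eq0; apply: contraNneq nW => /c_inj <-.
  have := IH (fun m => (c m - c n) *: f m) uW _ fS' m mW.
  rewrite -[f m in X in _ -> X]scale1r -(mulVf mn) -scalerA => H; apply/rpredZ/H.
  by move=> m' m'W; rewrite eZ fE ?in_cons ?m'W ?orbT // !scalerA mulrC.
move=> m; rewrite in_cons => /orP[/eqP ->|/fW //].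
have WS : \sum_(m <- W) f m \in S by rewrite big_seq rpred_sum.
by apply: (mem_congr (submod_closedB fS WS)); rewrite big_cons addrK.
Qed.

Lemma sum_parts (L : seq (K * seq g)) (f : K * seq g -> M) :
  \sum_(m <- undup [seq wt p.2 | p <- L]) \sum_(p <- L | wt p.2 == m) f p = \sum_(p <- L) f p.
Proof.
set W := undup _.
have -> : \sum_(m <- W) \sum_(p <- L | wt p.2 == m) f p =
    \sum_(m <- W) \sum_(p <- L) (if wt p.2 == m then f p else 0).
  by apply: eq_bigr => m _; rewrite big_mkcond.
rewrite exchange_big; apply: eq_big_seq => p pL /=.
have pW : wt p.2 \in W by rewrite mem_undup; apply: (map_f (fun q => wt q.2)).
rewrite (bigD1_seq (wt p.2)) ?undup_uniq //= eqxx big1 ?addr0 // => m.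
by rewrite eq_sym => /negPf ->.
Qed.

Lemma homogeneous_parts (S : submodClosed M) (L : seq (K * seq g)) :
  (forall u, u \in S -> e 0 u \in S) -> \sum_(p <- L) p.1 *: word p.2 \in S ->
  forall m, \sum_(p <- L | wt p.2 == m) p.1 *: word p.2 \in S.
Proof.
move=> S0 LS m; pose W := undup [seq wt p.2 | p <- L].
have [mW|mW] := boolP (m \in W); last first.
  rewrite big_seq_cond big_pred0 ?rpred0 // => p; apply: contraNF mW => /andP[pL /eqP <-].
  by rewrite mem_undup; apply: (map_f (fun q => wt q.2)).
pose f k := \sum_(p <- L | wt p.2 == k) p.1 *: word p.2.
apply: (@eigen_parts S W f) => //; first exact: undup_uniq.
  move=> k _; rewrite /f big_mkcond e_sum scaler_sumr; apply: eq_bigr => p _.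
  case: eqP => [<-|_]; last by rewrite e0 scaler0.
  by rewrite eZ e_zero_word !scalerA mulrC.
by rewrite /f sum_parts.
Qed.

(** Some homogeneous part of [w] is nonzero; it lies in [S] by stability under [e 0], and its weight
    is negative because only nonempty words occur. *)
Lemma raise_aug (S : submodClosed M) w :
  (forall i u, 0 <= val i -> u \in S -> e i u \in S) ->
  w \in S -> w != 0 -> w \in aug_span -> exists2 i, neg i & e i v \in S.
Proof.
move=> Se wS w0 /(@lspan_words _ (fun s => s != [::] /\ all neg s))[|L LP wE].
  by move=> u [s [s0 ns ->]]; exists s.
have S0 u : u \in S -> e 0 u \in S by apply: Se.
have LS : \sum_(p <- L) p.1 *: word p.2 \in S by rewrite -wE.
pose f m := \sum_(p <- L | wt p.2 == m) p.1 *: word p.2.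
have [m mL fm] : exists2 m, m \in [seq wt p.2 | p <- L] & f m != 0.
  apply: contrapT => f0; case/eqP: w0; rewrite wE -sum_parts big_seq big1 // => m.
  rewrite mem_undup => mL; apply/eqP; rewrite -[_ == 0]negbK; apply/negP => fm.
  by apply: f0; exists m.
have m0 : val m < 0.
  by have /mapP[p pL ->] := mL; have [s0 ns] := LP _ pL; apply: wt_neg_lt.
apply: (@raise_homogeneous S (\max_(p <- L) size p.2).+1 m (f m)) => //.
  exact: homogeneous_parts.
rewrite /f big_seq_cond rpred_sum // => p /andP[pL /eqP pm]; rewrite rpredZ //.
have [_ ns] := LP _ pL; apply: mem_word_fil => //.
by rewrite ltnS (leq_bigmax_seq (F := fun p : K * seq g => size p.2)).
Qed.

(** From [e_i v], the operator [e_(m-i)] gives [e_m v] for [m] between [i] and 0, with the nonzero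
    factor [c (2i - m)]. Brackets of two such letters then double the range repeatedly, and longer
    words follow by stability. *)
Lemma gen_aug (S : submodClosed M) i : (forall j u, u \in S -> e j u \in S) ->
  neg i -> e i v \in S -> forall w, w \in aug_span -> w \in S.
Proof.
move=> Se i0 iS.
have down m : val i <= val m -> neg m -> e m v \in S.
  move=> im m0; have := Se (m - i) _ iS.
  rewrite e_comm [e (m - i) v]v_e ?grp_valB ?subr_ge0 // e0 add0r subrK raddfB => mS.
  have x0 : c i - (c m - c i) != 0.
    rewrite opprB addrA -cD -raddfB; apply/eqP => /c_eq0 /(congr1 val).
    rewrite grp_valB vD grp_val0; move: i0 m0 im; rewrite !negE; lra.
  by apply: (mem_congr (rpredZ (c i - (c m - c i))^-1 mS)); rewrite scalerA mulVf ?scale1r.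
pose P (x : R) := forall m, neg m -> - x < val m -> e m v \in S.
have dbl x : P x -> P (x * 2%:R).
  move=> Px m m0 mx; have [mx'|mx'] := ltP (- x) (val m); first exact: Px.
  (* With [a] below half of [m], the letters [a] and [m - a] are distinct and negative, and both lie
     in the range already covered. *)
  have [|a a1 a2] := @grp_dense R G G_nontrivial G_not_Z (Num.max (- x) (val m)) (val m / 2%:R).
    by rewrite gt_max; apply/andP; split; move: m0; rewrite negE; lra.
  move: a1; rewrite gt_max => /andP[a1 a3].
  pose b := m - a; have bE : val b = val m - val a by [].
  have a0 : neg a by move: m0; rewrite !negE; lra.
  have b0 : neg b by rewrite negE bE; lra.
  have aS := Se b _ (Px _ a0 a1).
  have bS : e a (e b v) \in S by apply/Se/Px => //; rewrite bE; lra.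
  have := submod_closedB bS aS; rewrite [e a (e b v)]e_comm addrC addKr.
  have -> : a + b = m by rewrite /b addrC subrK.
  move=> mS.
  have x0 : c b - c a != 0.
    by rewrite subr_eq0; apply/eqP => /c_inj/(congr1 val); rewrite bE; lra.
  by apply: (mem_congr (rpredZ (c b - c a)^-1 mS)); rewrite scalerA mulVf ?scale1r.
have Pn n : P (- val i * 2%:R ^+ n).
  elim: n => [|n /dbl]; last by rewrite exprSr mulrA.
  by rewrite expr0 mulr1 => m m0 im; apply: down => //; rewrite ltW // -[val i]opprK.
have all_neg m : neg m -> e m v \in S.
  move=> m0; apply: (Pn (Num.bound (val m / val i))) => //.
  rewrite mulNr opprK mulrC -ltr_ndivrMr //.
  apply: lt_le_trans (archi_boundP _) _.
    by rewrite ltW // -mulrNN -invrN divr_gt0 // oppr_gt0.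
  by rewrite -natrX ler_nat ltnW // ltn_expl.
apply: (@lspan_op _ _ _ id) => // _ [s [s0 ns ->]].
elim: s s0 ns => [//|a [|b s] IH] _ /= /andP[a0 ns]; first exact: all_neg.
by apply/Se/IH.
Qed.

(** In weight zero only the empty word occurs, so this part of [w] is a multiple of [v], and a
    nonzero one because [w] is outside [aug_span]. *)
Lemma proper_sub_aug (S : submodClosed M) w : (forall u, u \in S -> e 0 u \in S) ->
  w \in S -> w \in neg_span -> w \notin aug_span -> v \in S.
Proof.
move=> S0 wS + wA => /(@lspan_words _ (fun s => all neg s))[|L LP wE].
  by move=> u [s ns ->]; exists s.
have nilE p : p \in L -> (wt p.2 == 0) = (p.2 == [::]).
  move=> /LP ns; apply/eqP/eqP => [w0|->]; last by rewrite /wt big_nil.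
  apply/eqP; apply: contraT => /(wt_neg_lt ns); rewrite w0.
  by rewrite grp_val0 ltxx.
have LS : \sum_(p <- L) p.1 *: word p.2 \in S by rewrite -wE.
have := homogeneous_parts S0 LS 0.
pose x := \sum_(p <- L | wt p.2 == 0) p.1.
have xE : \sum_(p <- L | wt p.2 == 0) p.1 *: word p.2 = x *: v.
  rewrite scaler_suml big_seq_cond [RHS]big_seq_cond; apply: eq_bigr => p /andP[pL].
  by rewrite nilE // => /eqP ->.
rewrite xE.
have [x0 _|x0 xS] := eqVneq x 0; last first.
  by apply: (mem_congr (rpredZ x^-1 xS)); rewrite scalerA mulVf // scale1r.
case/negP: wA; rewrite wE (bigID (fun p => wt p.2 == 0)) /= rpredD //.
  by rewrite xE x0 scale0r rpred0.
rewrite big_seq_cond rpred_sum // => p /andP[pL]; rewrite nilE // => p0.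
by rewrite rpredZ //; apply: mem_lspan; exists p.2; split=> //; exact: LP.
Qed.

(** Each application raises the weight by [i] until it is positive, where nothing is left. Vanishing
    for all larger exponents lets sums take a maximum. *)
Lemma neg_span_nilp i w : 0 < val i -> w \in neg_span ->
  exists n, forall n', (n <= n')%N -> iter n' (e i) w = 0.
Proof.
move=> i0; move: w; apply: lspan_ind => [|x u1 u2 [n1 H1] [n2 H2]|_ [s ns ->]].
- by exists 0%N => n _; elim: n => //= n ->.
- exists (maxn n1 n2) => n; rewrite geq_max => /andP[/H1 n1n /H2 n2n].
  have -> : iter n (e i) (x *: u1 + u2) = x *: iter n (e i) u1 + iter n (e i) u2.
    by elim: n {n1n n2n} => //= n ->; rewrite e_linear.
  by rewrite n1n n2n scaler0 addr0.
have itF n : iter n (e i) (word s) \in word_fil (size s).+1 (i *+ n + wt s).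
  elim: n => [|n IH] /=; first by rewrite mulr0n add0r mem_word_fil.
  by rewrite mulrS -addrA word_fil_nneg // ltW.
have x0 : 0 <= - val (wt s) / val i.
  by rewrite divr_ge0 ?oppr_ge0 ?wt_neg // ltW.
exists (Num.bound (- val (wt s) / val i)) => n nb; apply: word_fil_pos (itF n).
have -> : val (i *+ n + wt s) = val i * n%:R + val (wt s).
  by rewrite vD (raddfMn (val : g -> R)) mulr_natr.
rewrite -[X in _ < _ + X]opprK subr_gt0 mulrC -ltr_pdivrMr //.
by apply: lt_le_trans (archi_boundP x0) _; rewrite ler_nat.
Qed.

(** The line through [w] is stable under the nonnegative part, so it contains some [e_i v]. For
    [0 < j < -i], [e_j] kills the line but sends [e_i v] to a nonzero multiple of [e_(i+j) v]. *)
Lemma no_singular_vector w (x : K) : (forall a, neg a -> e a v != 0) ->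
  w \in aug_span -> w != 0 -> (forall i, 0 < val i -> e i w = 0) -> e 0 w = x *: w -> False.
Proof.
move=> ev wA w0 wi we0; pose S := lspan (fun u => u = w).
have SE u : u \in S -> exists y, u = y *: w.
  move: u; apply: lspan_ind => [|y u1 u2 [y1 ->] [y2 ->]|_ ->].
  - by exists 0; rewrite scale0r.
  - by exists (y * y1 + y2); rewrite scalerDl scalerA.
  - by exists 1; rewrite scale1r.
have wS : w \in S by apply: mem_lspan.
have [|i i0 /SE[y ivE]] := @raise_aug S w _ wS w0 wA.
  move=> i u i0 /SE[y ->]; rewrite eZ rpredZ //.
  move: i0; rewrite le_eqVlt => /orP[/eqP i0|i0]; last by rewrite wi ?rpred0.
  by rewrite (_ : i = 0) ?we0 ?rpredZ //; apply: val_inj.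
have /(@grp_dense R G G_nontrivial G_not_Z)[j j0 ji] : 0 < - val i by rewrite oppr_gt0.
have /(congr1 (e j)) := ivE; rewrite eZ wi // scaler0 e_comm v_e ?ltW // e0 add0r.
have ijn : neg (j + i) by rewrite negE vD -ltrBrDr sub0r.
move/eqP; rewrite scaler_eq0 (negPf (ev _ ijn)) orbF subr_eq0 => /eqP/c_inj ij.
by move: i0; rewrite negE ij ltNge ltW.
Qed.

End WittModule.

(** * Radical and simple top of the module *)

Section HighestWeightZero.
Variables (R : realType) (G : zmodClosed R).
Local Notation C := (complex R).
Local Notation g := (grp G).
Local Notation neg := (@neg_idx R G).
Hypothesis G_nontrivial : exists2 x : R, x \in G & x != 0.
Hypothesis G_not_Z : forall f : {additive g -> int}, ~ bijective f.
Variables (M : lieModType (vir G)) (v : M).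
Hypothesis v_e : forall i : g, 0 <= val i -> lact (vir_e i) v = 0.
Hypothesis v_c : lact (vir_c G) v = 0.
Hypothesis v_gen : generates v.
Hypothesis v_neg : forall a, neg a -> lact (vir_e a) v != 0.
Hypothesis v_notin : v \notin
  lspan (fun w => exists s, [/\ s != [::], all neg s & w = vword v s]).

Local Notation e := (fun i : g => lact (vir_e i) : M -> M).
Local Notation A := (lspan (fun w => exists s, [/\ s != [::], all neg s & w = vword v s])).

Implicit Types (w u : M) (q : top_lmod M).

Lemma lact0l w : lact (0 : vir G) w = 0.
Proof. by have := lactZl 0 (0 : vir G) w; rewrite !scale0r. Qed.

(** The vectors killed by the central element form a submodule, and the generator [v] is among
    them. *)
Lemma lact_c w : lact (vir_c G) w = 0.
Proof.
pose Z : {pred M} := fun w => lact (vir_c G) w == 0.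
have Zs : submod_closed Z.
  split=> [|x u1 u2 /eqP u1Z /eqP u2Z]; apply/eqP; first exact: lact0r.
  by rewrite lactDr lactZr u1Z u2Z scaler0 addr0.
have Zl x u : u \in Z -> lact x u \in Z.
  move=> /eqP uZ; apply/eqP; have := lact_lie x (vir_c G) u.
  by rewrite lie_c lact0l uZ lact0r sub0r => /esym/eqP; rewrite oppr_eq0 => /eqP.
by apply/eqP; apply: (v_gen (S := LieSubmod Zs Zl)); apply/eqP.
Qed.

Lemma lact_e_linear i : linear (e i).
Proof. by move=> x u w; rewrite lactDr lactZr. Qed.

Lemma lact_e_comm (i j : g) w :
  e i (e j w) = e j (e i w) + (idx j - idx i) *: e (i + j) w.
Proof.
have <- : lact (lie (vir_e i) (vir_e j)) w = (idx j - idx i) *: e (i + j) w.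
  apply: etrans (congr1 (fun x => lact x w) (lie_e i j)) _.
  apply: etrans (lactDl _ _ _) _; apply: etrans (congr2 +%R (lactZl _ _ _) (lactZl _ _ _)) _.
  by rewrite lact_c scaler0 addr0.
by rewrite lact_lie addrC subrK.
Qed.

Lemma idx0 (i : g) : idx i = 0 -> i = 0.
Proof. by move=> /eqP; rewrite idx_eq0 => /eqP i0; apply: val_inj. Qed.

Lemma lact_sub (S : submodClosed M) w : (forall i, e i w \in S) -> forall x, lact x w \in S.
Proof.
move=> Sw; apply: vir_lin_ind => [|a x y xS yS|//|].
- by rewrite lact0l rpred0.
- by rewrite lactDl lactZl rpredD ?rpredZ.
- by rewrite lact_c rpred0.
Qed.

Lemma neg_span_full w : w \in neg_span e v.
Proof.
have Nl x u : u \in neg_span e v -> lact x u \in neg_span e v.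
  move=> uN; apply: lact_sub => i.
  exact: (neg_span_e lact_e_linear lact_e_comm v_e).
have Ns : submod_closed (neg_span e v) by exact: lspan_submod_closed.
apply: (v_gen (S := LieSubmod Ns Nl)).
by apply: mem_lspan; exists [::].
Qed.

Lemma lact_aug x w : lact x w \in A.
Proof.
apply: lact_sub => i; apply: (aug_span_e lact_e_linear lact_e_comm v_e).
exact: neg_span_full.
Qed.

Definition aug_submod : lieSubmod M :=
  LieSubmod (lspan_submod_closed _) (fun x w (_ : w \in A) => lact_aug x w).

Lemma aug_decomp w : exists x, w - x *: v \in A.
Proof. exact: (neg_span_aug (neg_span_full w)). Qed.

Lemma sub_all_or_aug (S : lieSubmod M) : (forall w, w \in S) \/ {subset S <= A}.
Proof.
have [?|SA] := pselect {subset S <= A}; [by right|left].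
have [w [wS wA]] : exists w, w \in S /\ w \notin A.
  apply: contrapT => nw; apply: SA => w wS; apply: contrapT => wA.
  by apply: nw; exists w; split=> //; apply/negP.
apply: v_gen; apply: (@proper_sub_aug _ _ _ _ _ _ _ idx0 lact_e_linear lact_e_comm v_e S w) => //.
  by move=> u; apply: lact_closed.
exact: neg_span_full.
Qed.

Lemma maximal_aug : maximal_submod aug_submod.
Proof.
split=> [|T AT]; first by exists v.
by have [TT|TA] := sub_all_or_aug T; [right|left].
Qed.

(** [A] is the only maximal submodule: a maximal one is proper, hence contained in [A], hence equal
    to it. *)
Lemma rad_aug w : (w \in lie_rad M) = (w \in A).
Proof.
apply/idP/idP => [/asboolP/(_ _ maximal_aug)//|wA].
apply/asboolP => S [[u uS] Smax].
have [SS|SA] := sub_all_or_aug S; first by rewrite SS in uS.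
have [AS|AA] := Smax aug_submod SA; first exact: AS.
by have := v_notin; rewrite AA.
Qed.

Local Notation top := (top_lmod M).
Local Notation p := (top_proj M).
Local Notation vbar := (p v).

Lemma top_proj_eq0 w : (p w == 0) = (w \in A).
Proof. by rewrite -rad_aug -(raddf0 p) [LHS]quot_projE subr0. Qed.

Lemma vbar_neq0 : vbar != 0.
Proof. by rewrite top_proj_eq0. Qed.

Lemma top_span (q : top) : exists x, q = x *: vbar.
Proof.
elim/quot_ind: q => w; have [x wx] := aug_decomp w; exists x.
apply/eqP; rewrite -subr_eq0 -[_ *: _]linearZ -[_ - _](linearB p).
by rewrite top_proj_eq0.
Qed.

(** The coordinate along the class of [v], obtained by choice; its uniqueness, from [vbar_neq0],
    gives linearity. *)
Definition top_coef (q : top) : triv_lmod (vir G) := sval (cid (top_span q)).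

Lemma top_coefK q : top_coef q *: vbar = q.
Proof. by rewrite /top_coef; case: cid => x /= ->. Qed.

Lemma top_scale_inj (x y : C) : x *: vbar = y *: vbar -> x = y.
Proof.
move/eqP; rewrite -subr_eq0 -scalerBl scaler_eq0 (negPf vbar_neq0) orbF subr_eq0.
by move/eqP.
Qed.

Lemma lact_top x (q : top) : lact x q = 0.
Proof.
elim/quot_ind: q => w; apply/eqP.
by rewrite -[X in X == _]/(lact x (p w)) -lact_morph top_proj_eq0 lact_aug.
Qed.

Fact top_coef_linear : linear top_coef.
Proof.
move=> a q1 q2; apply: top_scale_inj; rewrite top_coefK scalerDl -scalerA.
by rewrite !top_coefK.
Qed.
HB.instance Definition _ :=
  GRing.isLinear.Build C top (triv_lmod (vir G)) _ top_coef top_coef_linear.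

Fact top_coef_equivariant (x : vir G) (q : top) : top_coef (lact x q) = lact x (top_coef q).
Proof. by rewrite lact_top raddf0. Qed.
HB.instance Definition _ := isLieEquivariant.Build C (vir G) top (triv_lmod (vir G))
  top_coef top_coef_equivariant.

Lemma top_triv : exists f : lieHom top (triv_lmod (vir G)), bijective f.
Proof.
exists top_coef; exists (fun x : C => x *: vbar) => [q|x]; first exact: top_coefK.
by apply: top_scale_inj; rewrite top_coefK.
Qed.

Lemma top_simple : simple_lmod top.
Proof.
split=> [|S]; first by exists vbar; exact: vbar_neq0.
have [?|nS] := pselect (forall q, q \in S -> q = 0); [by left|right=> q].
have [q' q'S q'0] : exists2 q', q' \in S & q' != 0.
  apply: contrapT => H; apply: nS => q' q'S; apply/eqP; rewrite -[_ == 0]negbK.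
  by apply/negP => q'0; apply: H; exists q'.
have x0 : top_coef q' != 0 by apply: contraNneq q'0 => x0; rewrite -[q']top_coefK x0 scale0r.
rewrite -[q]top_coefK rpredZ //.
by rewrite -[vbar]scale1r -(mulVf x0) -scalerA top_coefK rpredZ.
Qed.

(** * The kernel of the projection onto the top *)

Local Notation N := (sub_lmod (lie_ker p)).

Lemma ker_aug w : (w \in lie_ker p) = (w \in A).
Proof. by rewrite -top_proj_eq0. Qed.

Lemma sub_lmod_val_aug (t : N) : val t \in A.
Proof. by rewrite -ker_aug; exact: sub_lmodP. Qed.

Let valN0 : val (0 : N) = 0 :> M. Proof. by rewrite raddf0. Qed.
Let valNP (x : C) (t1 t2 : N) : val (x *: t1 + t2) = x *: val t1 + val t2 :> M.
Proof. by rewrite linearP. Qed.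

Lemma ker_simple : simple_lmod N.
Proof.
split.
  have [i i0] := grp_pos_ex G_nontrivial.
  have in0 : neg (- i) by rewrite /neg_idx grp_valN oppr_lt0.
  have eA : lact (vir_e (- i)) v \in lie_ker p by rewrite ker_aug lact_aug.
  exists (SubLmod eA); apply: contraNneq (v_neg in0) => E.
  by rewrite -[lact _ _]/(val (SubLmod eA)) E valN0.
(* The submodule is carried over to [M], where [raise_aug] finds some [e_i v] in it and [gen_aug]
   recovers all of [A]. *)
move=> S; pose Z : {pred M} := fun w => `[< exists2 t : N, t \in S & val t = w >].
have Zs : submod_closed Z.
  split=> [|x u1 u2 /asboolP[t1 t1S <-] /asboolP[t2 t2S <-]]; apply/asboolP.
    by exists 0; rewrite ?rpred0 // valN0.
  by exists (x *: t1 + t2); rewrite ?rpredD ?rpredZ // valNP.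
have Zl x u : u \in Z -> lact x u \in Z.
  move=> /asboolP[t tS <-]; apply/asboolP; exists (lact x t) => //.
  exact: lact_closed.
pose ZS := LieSubmod Zs Zl.
have [?|nS] := pselect (forall t, t \in S -> t = 0); [by left|right=> t].
have [t' t'S t'0] : exists2 t', t' \in S & t' != 0.
  apply: contrapT => H; apply: nS => t' t'S; apply/eqP; rewrite -[_ == 0]negbK.
  by apply/negP => t'0; apply: H; exists t'.
have t'Z : val t' \in ZS by apply/asboolP; exists t'.
have t'n0 : val t' != 0 by apply: contraNneq t'0 => t'0; apply/eqP/val_inj; rewrite t'0 valN0.
have [i i0 iZ] := @raise_aug _ _ _ (@idx R G) _ _ _ idx0 lact_e_linear lact_e_comm v_e
  G_nontrivial G_not_Z ZS _ (fun i u _ uZ => lact_closed (vir_e i) uZ) t'Z t'n0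
  (sub_lmod_val_aug t').
have /asboolP[t'' t''S /val_inj <- //] : val t \in ZS.
exact: (@gen_aug _ _ _ (@idx R G) _ _ _ idx0 lact_e_linear lact_e_comm v_e
  G_nontrivial G_not_Z ZS i (fun i u uZ => lact_closed (vir_e i) uZ) i0 iZ _ (sub_lmod_val_aug t)).
Qed.

Lemma ker_locally_nilpotent x : root_vector x -> locally_nilpotent N x.
Proof.
move=> [a a0 [i i0 ->]] t.
have [n nP] := @neg_span_nilp _ _ _ (@idx R G) _ _ _ lact_e_linear lact_e_comm v_e i (val t) i0
  (neg_span_full _).
exists n.+1; split=> //; apply: val_inj.
have -> m : val (iter m (lact (a *: vir_e i)) t) = a ^+ m *: iter m (e i) (val t).
  elim: m => [|m IH]; first by rewrite expr0 scale1r.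
  by rewrite !iterS [LHS]/= IH lactZl lactZr scalerA exprS.
by rewrite nP // scaler0 valN0.
Qed.

(** A highest weight vector of the kernel would be a singular eigenvector of [e 0] in [A]. *)
Lemma ker_not_highest_weight : ~ highest_weight_lmod N.
Proof.
move=> [t [t0 _ tn [lambda tl]]].
have h0 : vir_e 0 \in lspan (@cartan_gen R G) by apply: mem_lspan; left.
have t0E : e 0 (val t) = lambda (LspanType h0) *: val t by have /(congr1 val) := tl (LspanType h0).
have vt0 : val t != 0 by apply: contraNneq t0 => vt0; apply/eqP/val_inj; rewrite vt0 valN0.
have ti (i : g) : 0 < val i -> e i (val t) = 0.
  move=> i0; have iN : vir_e i \in @n_plus R G by apply: mem_lspan; exists i.
  by have /(congr1 val) := tn _ iN; rewrite valN0.
exact: (@no_singular_vector _ _ _ (@idx R G) _ _ _ idx0 lact_e_linear lact_e_comm v_e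
  G_nontrivial G_not_Z (val t) _ v_neg (sub_lmod_val_aug t) vt0 ti t0E).
Qed.

End HighestWeightZero.

Theorem mainTheorem2 (R : realType) (G : zmodClosed R)
    (G_nontrivial : exists2 x : R, x \in G & x != 0)
    (G_not_Z : forall f : {additive grp G -> int}, ~ bijective f) :
  [/\ simple_lmod (L0 G),
      exists f : lieHom (L0 G) (triv_lmod (vir G)), bijective f,
      simple_lmod (K0 G),
      forall x : vir G, root_vector x -> locally_nilpotent (K0 G) x
    & ~ highest_weight_lmod (K0 G)]
  /\ ~ (forall V : lieModType (vir G),
          simple_lmod V ->
          (forall x : vir G, root_vector x -> locally_nilpotent V x) ->
          highest_weight_lmod V).
Proof.
have ve := @verma0_vec_e R G; have vc := verma0_vec_c G.
have vg := @verma0_generates R G; have vn := @verma0_e_neq0 R G.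
have va := verma0_vec_notin G.
have Ks := ker_simple G_nontrivial G_not_Z ve vc vg vn va.
have Kn := ker_locally_nilpotent ve vc vg.
have Kh := ker_not_highest_weight G_nontrivial G_not_Z ve vc vg vn va.
(* K(0) itself refutes the general claim. *)
split; last by move/(_ _ Ks Kn).
split=> //.
- exact: top_simple ve vc vg va.
- exact: top_triv ve vc vg va.
Qed.
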